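(* For Lebesgue-almost every triangle $\Delta$ (in the space of triangles up to similarity, parametrized by two of its angles $(\alpha,\beta)$ ranging over $\{\alpha>0,\beta>0,\alpha+\beta<\pi\}$ with Lebesgue measure) the following holds: for every $\epsilon>0$ there is a constant $C>0$ such that for all $n\ge1$, $$\mathrm{Per}_n(\Delta)<C\,e^{n^{\sqrt{3}-1+\epsilon}}.$$
   Context: For the billiard in a triangle $\Delta$, the combinatorial type of a periodic billiard orbit is the (cyclic) sequence of sides of $\Delta$ it hits. The length of a periodic orbit is its number of reflections per period. $\mathrm{Per}_n(\Delta)$ denotes the number of distinct combinatorial types of periodic billiard orbits in $\Delta$ of length at most $n$. *)

(* Defs.v *)
From HB Require Import structures.
From mathcomp Require Import all_boot all_order all_algebra.
From mathcomp Require Import all_classical all_reals all_analysis.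
Set Implicit Arguments. Unset Strict Implicit. Unset Printing Implicit Defensive.
Import Order.TTheory GRing.Theory Num.Theory.
Local Open Scope ring_scope.

Section Billiard.
Variable R : realType.

Definition point := (R * R)%type.
Definition padd (p q : point) : point := (p.1 + q.1, p.2 + q.2).
Definition psub (p q : point) : point := (p.1 - q.1, p.2 - q.2).
Definition pscale (c : R) (p : point) : point := (c * p.1, c * p.2).
Definition dot (p q : point) : R := p.1 * q.1 + p.2 * q.2.

(* The triangle with angle a at vertex 0 = (0,0), angle b at vertex 1 = (1,0),
   and third vertex 2 = (t cos a, t sin a), t = sin b / sin (a+b)
   (law of sines); its third angle is pi - a - b. *)
Definition vertex (a b : R) (i : 'I_3) : point :=
  match val i with
  | 0 => (0, 0)
  | 1 => (1, 0)
  | _ => let t := sin b / sin (a + b) in (t * cos a, t * sin a)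
  end.

(* Side i is the side opposite to vertex i: from vertex (i+1) to vertex (i+2). *)
Definition side_start (a b : R) (i : 'I_3) : point := vertex a b (ordS i).
Definition side_end (a b : R) (i : 'I_3) : point := vertex a b (ordS (ordS i)).

Definition on_side (a b : R) (i : 'I_3) (p : point) : Prop :=
  exists t : R, 0 < t /\ t < 1 /\
    p = padd (pscale (1 - t) (side_start a b i)) (pscale t (side_end a b i)).

Definition reflect (u d : point) : point :=
  psub (pscale (2 * dot d u / dot u u) u) d.

Definition code (k : nat) (w : k.-tuple 'I_3) (j : nat) : 'I_3 :=
  nth ord0 w (j %% k).

Definition periodic_type (a b : R) (k : nat) (w : k.-tuple 'I_3) : Prop :=
  exists p : nat -> point,
    (forall j, p (j + k)%N = p j) /\
    (forall j, on_side a b (code w j) (p j)) /\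
    (forall j, code w j != code w j.+1) /\
    (forall j, exists lam : R, 0 < lam /\
        psub (p j.+2) (p j.+1) =
        pscale lam (reflect (psub (side_end a b (code w j.+1))
                                  (side_start a b (code w j.+1)))
                            (psub (p j.+1) (p j)))).

Definition cyc_class (k : nat) (w : k.-tuple 'I_3) : {set k.-tuple 'I_3} :=
  [set [tuple of rot i w] | i : 'I_k].

Definition Per_exact (a b : R) (k : nat) : nat :=
  #| (@cyc_class k) @: [set w : k.-tuple 'I_3 | `[< periodic_type a b w >]] |.

Definition Per (a b : R) (n : nat) : nat :=
  (\sum_(1 <= k < n.+1) Per_exact a b k)%N.

Definition triangle_params : set (R * R) :=
  [set ab | 0 < ab.1 /\ 0 < ab.2 /\ ab.1 + ab.2 < pi].

End Billiard.

(* Main.v *)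
Require Import Defs.
From HB Require Import structures.
From mathcomp Require Import all_boot all_order all_algebra.
From mathcomp Require Import all_classical all_reals all_analysis.
From mathcomp Require Import measurable_realfun complex ring lra zify.
Set Implicit Arguments. Unset Strict Implicit. Unset Printing Implicit Defensive.
Import Order.TTheory GRing.Theory Num.Theory numFieldNormedType.Exports.
Local Open Scope classical_set_scope.
Local Open Scope ring_scope.

(** Unfold the trajectories in the plane.  The cross product of two differences
    of vertices of an unfolding of length at most m is, up to a denominator of
    size exp(O(m)), an integer polynomial of degree O(m) in x = cot a and
    y = cot b.  Such a polynomial, if nonzero, has absolute value at least
    exp(-O(m^2)) outside a set of angles of measure exp(-cm), because it is
    small only near the real parts of its roots; there are exp(O(m)) of them,
    so by Borel-Cantelli this lower bound holds for almost every triangle and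
    all large m: three vertices which are nearly collinear are collinear.

    Now group the trajectories of length n by their initial position and
    direction up to exp(-cm^2), with m = n^(1/3).  A vertex which separates two
    trajectories of a group is very close to all of them.  If three such
    vertices occur, sufficiently far apart, within m steps along one trajectory,
    then they lie on a common line; so after passing on different sides of the
    first two, the group cannot be separated by the third.  Hence, inside a
    group, a block of m steps adds only polynomially many words, and the number
    of words is at most exp(O(m^2 + (n/m) log n)) = exp(O(n^(2/3) log n)), where
    2/3 < sqrt 3 - 1. *)

Local Notation point := Defs.point.
Local Notation mirror := Defs.reflect.
Local Notation code := Defs.code.

(** * Coding itineraries *)

Section Coding.
Variables (T B C : finType) (S : {set T}) (box : T -> B) (n : nat).
Variables (s : T -> nat -> bool) (cell : nat -> C).

Definition agree (w w' : T) (j : nat) : bool :=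
  (box w == box w') && [forall i : 'I_n, (i < j)%N ==> (s w i == s w' i)].

(** Two words witness the split and [w] itself need not be either of them, so the property depends
    only on the part of [w] before [j] and passes to every word agreeing with it up to then. *)
Definition split_at (w : T) (j : nat) : bool :=
  [exists w1 in S, exists w2 in S,
     [&& agree w w1 j, agree w w2 j & s w1 j != s w2 j]].

Lemma agreeP w w' j : (j <= n)%N ->
  reflect (box w = box w' /\ forall i, (i < j)%N -> s w i = s w' i) (agree w w' j).
Proof.
move=> jn; apply: (iffP andP) => -[/eqP -> h]; split=> //.
  move=> i ij; have in_ := leq_trans ij jn.
  by move/forallP: h => /(_ (Ordinal in_))/implyP/(_ ij)/eqP.
by apply/forallP => i; apply/implyP => /h ->.
Qed.

Lemma split_at_agree w w' j : (j <= n)%N -> agree w w' j -> split_at w j -> split_at w' j.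
Proof.
move=> jn /(agreeP _ _ jn)[bE sE] /exists_inP[w1 w1S /exists_inP[w2 w2S /and3P[]]].
move=> /(agreeP _ _ jn)[b1 s1] /(agreeP _ _ jn)[b2 s2] ne.
apply/exists_inP; exists w1 => //; apply/exists_inP; exists w2 => //.
rewrite ne andbT; apply/andP; split; apply/agreeP => //; split.
- by rewrite -bE.
- by move=> i ij; rewrite -sE// s1.
- by rewrite -bE.
- by move=> i ij; rewrite -sE// s2.
Qed.

(** The value [n], which [find] returns on failure, means that no such split occurs. *)
Definition first_split (w : T) (c : C) (b : bool) : 'I_n.+1 :=
  inord (find (fun j => [&& cell j == c, split_at w j & s w j == b]) (iota 0 n)).

Lemma first_split_le w b j : (j < n)%N -> split_at w j -> s w j = b ->
  (first_split w (cell j) b <= j)%N.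
Proof.
move=> jn sp sb; rewrite /first_split inordK; last first.
  by rewrite ltnS (leq_trans (find_size _ _))// size_iota.
rewrite leqNgt; apply/negP => /(before_find 0%N).
by rewrite nth_iota// add0n eqxx sp sb eqxx.
Qed.

Lemma first_splitP w c b : (first_split w c b < n)%N ->
  [/\ cell (first_split w c b) = c, split_at w (first_split w c b)
    & s w (first_split w c b) = b].
Proof.
rewrite /first_split inordK; last first.
  by rewrite ltnS (leq_trans (find_size _ _))// size_iota.
set P := (P in find P); set f := find _ _ => fn.
have : has P (iota 0 n) by rewrite has_find size_iota.
by move=> /(nth_find 0%N); rewrite nth_iota// add0n => /and3P[/eqP ? ? /eqP].
Qed.

(** For each cell only two times are kept, one per side; they replace the full list of sides. *)
Definition itinerary_code (w : T) : B * {ffun C * bool -> 'I_n.+1} :=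
  (box w, [ffun cb => first_split w cb.1 cb.2]).

Hypothesis code_separates : {in S &, forall w w', box w = box w' ->
  (forall j, (j < n)%N -> s w j = s w' j) -> w = w'}.
Hypothesis no_split_after_turn : {in S, forall w j1 j2 j3,
  (j1 < j3)%N -> (j2 < j3)%N -> (j3 < n)%N ->
  cell j1 = cell j3 -> cell j2 = cell j3 ->
  split_at w j1 -> split_at w j2 -> split_at w j3 -> s w j1 = s w j2}.

(* If two words first differ at time j, then the times recorded for the cell of
   j and the two sides would be two earlier splits with different sides. *)
Lemma itinerary_code_inj : {in S &, injective itinerary_code}.
Proof.
have key w w' j : w \in S -> w' \in S -> itinerary_code w = itinerary_code w' ->
    (j < n)%N -> agree w w' j -> s w j = true -> s w' j = false -> False.
  move=> wS w'S [bE /ffunP fE] jn ag st sf.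
  have spw : split_at w j.
    apply/exists_inP; exists w => //; apply/exists_inP; exists w' => //.
    rewrite ag st sf !andbT; apply/agreeP; [exact: ltnW|by []].
  have spw' := split_at_agree (ltnW jn) ag spw.
  have := fE (cell j, true); have := fE (cell j, false); rewrite !ffunE /=.
  move=> fF fT.
  have lT := first_split_le jn spw st; have lF := first_split_le jn spw' sf.
  have [cT sT vT] := first_splitP (leq_ltn_trans lT jn).
  have [cF sF vF] := first_splitP (leq_ltn_trans lF jn).
  (* The two codes agree, so if this time were [j], it would be a time at which [w'] takes the side
     [true]. *)
  have nT : (first_split w (cell j) true < j)%N.
    rewrite ltn_neqAle lT andbT; apply/eqP => eT.
    have := @first_splitP w' (cell j) true; rewrite -fT eT => /(_ jn)[_ _].
    by rewrite sf.
  have nF : (first_split w' (cell j) false < j)%N.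
    rewrite ltn_neqAle lF andbT; apply/eqP => eF.
    have := @first_splitP w (cell j) false; rewrite fF eF => /(_ jn)[_ _].
    by rewrite st.
  have [_ sE] := agreeP _ _ (ltnW jn) ag.
  have agF : agree w' w (first_split w' (cell j) false).
    apply/agreeP; first by rewrite ltnW// (ltn_trans nF).
    by split=> // i /ltn_trans/(_ nF) /sE.
  have spF := split_at_agree (ltnW (ltn_trans nF jn)) agF sF.
  (* These are two earlier splits of [w] in the cell of [j], on opposite sides; the hypothesis
     forbids a further split at [j]. *)
  have := no_split_after_turn wS nT nF jn cT cF sT spF spw.
  by rewrite vT sE// vF.
move=> w w' wS w'S cE; apply: code_separates => //; first by case: cE.
move=> j; have [k] := ubnP j; elim: k j => // k IH j jk jn.
have ag : agree w w' j.
  apply/agreeP; first exact: ltnW.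
  split; first by case: cE.
  by move=> i ij; apply: IH; [exact: leq_trans ij _|exact: ltn_trans ij jn].
have ag' : agree w' w j.
  have [bE sE] := agreeP _ _ (ltnW jn) ag.
  by apply/agreeP; [exact: ltnW|split=> // i /sE].
case sw : (s w j); case sw' : (s w' j) => //.
- by case: (key w w' j).
- by case: (key w' w j).
Qed.

Lemma card_itineraries : (#|S| <= #|B| * n.+1 ^ (#|C| * 2))%N.
Proof.
rewrite -(card_in_imset itinerary_code_inj) (leq_trans (max_card _))//.
by rewrite card_prod card_ffun card_prod card_bool card_ord.
Qed.

End Coding.

(** * Unfolding *)

Section PlaneVectors.
Variable R : realType.
Implicit Types (p q u d f z : point R) (c : R).

Definition cross p q : R := p.1 * q.2 - p.2 * q.1.

Lemma psub_telescope p q z : psub p z = padd (psub p q) (psub q z).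
Proof. by case: p q z => ? ? [? ?] [? ?]; rewrite /padd /psub /=; congr (_, _); ring. Qed.

Lemma dotZ c p q : dot p (pscale c q) = c * dot p q.
Proof. rewrite /dot /=; ring. Qed.

Lemma crossZl c p q : cross (pscale c p) q = c * cross p q.
Proof. rewrite /cross /=; ring. Qed.

Lemma crossZr c p q : cross p (pscale c q) = c * cross p q.
Proof. rewrite /cross /=; ring. Qed.

Lemma crossDr p q z : cross p (padd q z) = cross p q + cross p z.
Proof. rewrite /cross /=; ring. Qed.

Lemma dotDr p q z : dot p (padd q z) = dot p q + dot p z.
Proof. rewrite /dot /=; ring. Qed.

Lemma crossxx p : cross p p = 0.
Proof. rewrite /cross; ring. Qed.

Lemma dot_ge0 p : 0 <= dot p p.
Proof. by rewrite /dot addr_ge0// -expr2 sqr_ge0. Qed.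

Lemma lagrange p q : cross p q ^+ 2 + dot p q ^+ 2 = dot p p * dot q q.
Proof. rewrite /cross /dot; ring. Qed.

(** The right-hand side is the determinant of [p] and [q] in the orthonormal frame formed by [d] and
    its quarter turn. *)
Lemma cross_unit d p q : dot d d = 1 ->
  cross p q = dot d p * cross d q - cross d p * dot d q.
Proof. by move=> d1; rewrite -[LHS]mul1r -d1 /cross /dot; ring. Qed.

Lemma dot_unit d p : dot d d = 1 -> dot p p = dot d p ^+ 2 + cross d p ^+ 2.
Proof. by move=> d1; rewrite addrC lagrange d1 mul1r. Qed.

Lemma normr_sqr_le (x B : R) : 0 <= B -> x ^+ 2 <= B ^+ 2 -> `|x| <= B.
Proof. by move=> B0; rewrite -(real_normK (num_real x)) ler_pXn2r// nnegrE. Qed.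

Lemma coord_le_dot z (B : R) : 0 <= B -> dot z z <= B ^+ 2 -> `|z.1| <= B /\ `|z.2| <= B.
Proof.
rewrite /dot -!expr2 => B0 h; split; apply: normr_sqr_le => //; apply: le_trans h.
  by rewrite lerDl sqr_ge0.
by rewrite lerDr sqr_ge0.
Qed.

Lemma dot_le_unit d z (B : R) : 0 <= B -> dot d d = 1 -> dot z z <= B ^+ 2 -> `|dot d z| <= B.
Proof.
move=> B0 d1 h; apply: normr_sqr_le => //; apply: le_trans h.
by rewrite (dot_unit z d1) lerDl sqr_ge0.
Qed.

Lemma reflect_psub u p q : mirror u (psub p q) = psub (mirror u p) (mirror u q).
Proof.
(* Treating the inverse as an atom makes this a polynomial identity, valid for every [u]. *)
rewrite /Defs.reflect; move: (dot u u)^-1 => i.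
by rewrite /psub /pscale /dot /=; congr (_, _); ring.
Qed.

Lemma reflect_pscale u c p : mirror u (pscale c p) = pscale c (mirror u p).
Proof.
rewrite /Defs.reflect; move: (dot u u)^-1 => i.
by rewrite /psub /pscale /dot /=; congr (_, _); ring.
Qed.

Lemma reflectK u p : dot u u != 0 -> mirror u (mirror u p) = p.
Proof.
case: u p => u1 u2 [p1 p2]; rewrite /Defs.reflect /psub /pscale /dot /= => u0.
by congr (_, _); field.
Qed.

Lemma dot_reflect u p q : dot u u != 0 -> dot (mirror u p) (mirror u q) = dot p q.
Proof.
case: u p q => u1 u2 [p1 p2] [q1 q2]; rewrite /Defs.reflect /psub /pscale /dot /= => u0.
by field.
Qed.

Lemma cross_reflect u p q : dot u u != 0 ->
  cross (mirror u p) (mirror u q) = - cross p q.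
Proof.
case: u p q => u1 u2 [p1 p2] [q1 q2].
rewrite /Defs.reflect /psub /pscale /dot /cross /= => u0.
by field.
Qed.

Lemma reflect_axis u c : dot u u != 0 -> mirror u (pscale c u) = pscale c u.
Proof.
case: u => u1 u2; rewrite /Defs.reflect /psub /pscale /dot /= => u0.
by congr (_, _); field.
Qed.

End PlaneVectors.

Lemma ordS3 (i : 'I_3) : ordS (ordS (ordS i)) = i.
Proof. by apply/val_inj; case: i => -[|[|[|]]]. Qed.

Lemma ord3P (i j : 'I_3) : [\/ j = i, j = ordS i | j = ordS (ordS i)].
Proof.
case: i j => -[|[|[|//]]] i [[|[|[|//]]] j];
  by [constructor 1; apply/val_inj | constructor 2; apply/val_inj
     | constructor 3; apply/val_inj].
Qed.

Lemma ordS_neq (i : 'I_3) : ordS i != i.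
Proof. by case: i => -[|[|[|]]]. Qed.

Lemma ordSS_neq (i : 'I_3) : ordS (ordS i) != i.
Proof. by case: i => -[|[|[|]]]. Qed.

(** * Straightening a billiard trajectory by unfolding *)

Section Unfolding.
Variables (R : realType) (v : 'I_3 -> point R) (A : R).
Implicit Types (p q f : point R) (i : 'I_3) (w : nat -> 'I_3) (P : nat -> point R).

Definition edge i : point R := psub (v (ordS (ordS i))) (v (ordS i)).

Definition in_side i p : Prop := exists t : R, 0 < t /\ t < 1 /\
  p = padd (pscale (1 - t) (v (ordS i))) (pscale t (v (ordS (ordS i)))).

(** [A] is twice the area of the triangle; its positivity says that the vertices are in
    counterclockwise order. *)
Hypothesis A_gt0 : 0 < A.
Hypothesis area : forall i, cross (edge i) (psub (v i) (v (ordS i))) = A.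

(* A times the barycentric coordinate of p at the vertex i *)
Definition height i p : R := cross (edge i) (psub p (v (ordS i))).

Lemma edge_neq0 i : dot (edge i) (edge i) != 0.
Proof.
apply/negP => /eqP e0; have := lagrange (edge i) (psub (v i) (v (ordS i))).
rewrite e0 mul0r area => /eqP; rewrite paddr_eq0 ?sqr_ge0// sqrf_eq0.
by rewrite gt_eqF.
Qed.

Lemma height_sum i p :
  height i p + height (ordS i) p + height (ordS (ordS i)) p = A.
Proof. by rewrite -(area i) /height /edge !ordS3 /cross /psub /=; ring. Qed.

Lemma height_side i p q : in_side i p -> height i q = cross (edge i) (psub q p).
Proof.
by move=> [t [_ [_ ->]]]; rewrite /height /edge /cross /psub /padd /pscale /=; ring.
Qed.

Lemma height_side0 i p : in_side i p -> height i p = 0.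
Proof. by move=> /height_side ->; rewrite /cross /psub /=; ring. Qed.

(** A chord from side [i] to the next side cuts off the vertex [ordS (ordS i)] and leaves [v i] on
    its left. [cross_prev] is the mirror case, so the sign tells which side comes next. *)
Lemma cross_next i p q : in_side i p -> in_side (ordS i) q ->
  0 < cross (psub q p) (psub (v i) p).
Proof.
move=> [t [t0 [t1 ->]]] [s [s0 [s1 ->]]].
rewrite (_ : cross _ _ = (1 - s) * ((1 - t) * A)); first by rewrite !mulr_gt0 ?subr_gt0.
by rewrite -(area i) /edge !ordS3 /cross /psub /padd /pscale /=; ring.
Qed.

Lemma cross_prev i p q : in_side i p -> in_side (ordS (ordS i)) q ->
  cross (psub q p) (psub (v i) p) < 0.
Proof.
move=> [t [t0 [t1 ->]]] [s [s0 [s1 ->]]].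
rewrite (_ : cross _ _ = - (s * (t * A))); first by rewrite oppr_lt0 !mulr_gt0.
by rewrite -(area i) /edge !ordS3 /cross /psub /padd /pscale /=; ring.
Qed.

(** The sides [i] and [j] meet at [v k], and [r], [s] are the fractions of these sides from there to
    [p] and [q]. Squaring removes the orientation sign. *)
Lemma fan_cross i j k p q : i != j -> k != i -> k != j -> in_side i p -> in_side j q ->
  exists r s : R, [/\ 0 < r, 0 < s,
    cross (psub p (v k)) (psub q (v k)) ^+ 2 = (r * s * A) ^+ 2,
    exists l, psub p (v k) = pscale r (psub (v l) (v k)) &
    exists l, psub q (v k) = pscale s (psub (v l) (v k))].
Proof.
move=> ij ki kj [t [t0 [t1 ->]]] [s [s0 [s1 ->]]].
have [jE|jE|jE] := ord3P i j; first by rewrite jE eqxx in ij.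
- have kE : k = ordS (ordS i).
    by have [e|e|//] := ord3P i k; rewrite e ?jE eqxx in ki kj.
  rewrite kE jE !ordS3; exists (1 - t), s; split => //; first by rewrite subr_gt0.
  + by rewrite -(area i) /edge /cross /psub /padd /pscale /=; ring.
  + by exists (ordS i); rewrite /psub /padd /pscale /=; congr (_, _); ring.
  + by exists i; rewrite /psub /padd /pscale /=; congr (_, _); ring.
- have kE : k = ordS i.
    by have [e|//|e] := ord3P i k; rewrite e ?jE eqxx in ki kj.
  rewrite kE jE !ordS3; exists t, (1 - s); split => //; first by rewrite subr_gt0.
  + by rewrite -(area i) /edge /cross /psub /padd /pscale /=; ring.
  + by exists (ordS (ordS i)); rewrite /psub /padd /pscale /=; congr (_, _); ring.
  + by exists i; rewrite /psub /padd /pscale /=; congr (_, _); ring.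
Qed.

(** The reflection of the plane in the line through side [i]. *)
Definition fold_side i p : point R := padd (v (ordS i)) (mirror (edge i) (psub p (v (ordS i)))).

Lemma fold_psub i p q : psub (fold_side i p) (fold_side i q) = mirror (edge i) (psub p q).
Proof.
rewrite (psub_telescope p (v (ordS i)) q).
have -> : psub (v (ordS i)) q = pscale (-1) (psub q (v (ordS i))).
  by rewrite /psub /pscale /=; congr (_, _); ring.
have -> x y : padd x (pscale (-1) y) = psub x y :> point R.
  by rewrite /psub /pscale /padd /=; congr (_, _); ring.
rewrite reflect_psub /fold_side.
by rewrite /psub /padd /=; congr (_, _); ring.
Qed.

Lemma fold_fix i (t : R) p : p = padd (pscale (1 - t) (v (ordS i))) (pscale t (v (ordS (ordS i)))) ->
  fold_side i p = p.
Proof.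
move=> ->; rewrite /fold_side.
have -> : psub (padd (pscale (1 - t) (v (ordS i))) (pscale t (v (ordS (ordS i)))))
   (v (ordS i)) = pscale t (edge i).
  by rewrite /edge /psub /pscale /padd /=; congr (_, _); ring.
rewrite reflect_axis ?edge_neq0// /edge /psub /pscale /padd /=; congr (_, _); ring.
Qed.

Lemma fold_fix_side i p : in_side i p -> fold_side i p = p.
Proof. by move=> [t [_ [_]]] /fold_fix. Qed.

Lemma fold_fix_vertex i k : k != i -> fold_side i (v k) = v k.
Proof.
have [->|->|->] := ord3P i k; rewrite ?eqxx// => _.
  by apply: (@fold_fix _ 0); rewrite /pscale /padd /=; apply/esym; case: (v _) => ? ?; congr (_, _) => /=; ring.
by apply: (@fold_fix _ 1); rewrite /pscale /padd /=; apply/esym; case: (v (ordS (ordS i))) => ? ?; congr (_, _) => /=; ring.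
Qed.

(* The isometry carrying the triangle to its j-th unfolded copy, the trajectory
   starting inside the triangle and crossing the sides w 1, w 2, ... in turn. *)
Fixpoint frame w j p : point R :=
  if j is j'.+1 then frame w j' (fold_side (w j) p) else p.

(** The linear part of [frame], acting on displacements. *)
Fixpoint lframe w j f : point R :=
  if j is j'.+1 then lframe w j' (mirror (edge (w j)) f) else f.

Lemma frame_psub w j p q : psub (frame w j p) (frame w j q) = lframe w j (psub p q).
Proof. by elim: j p q => //= j IH p q; rewrite IH fold_psub. Qed.

Lemma dot_lframe w j p q : dot (lframe w j p) (lframe w j q) = dot p q.
Proof. by elim: j p q => //= j IH p q; rewrite IH dot_reflect// edge_neq0. Qed.

Lemma cross_lframe w j p q : cross (lframe w j p) (lframe w j q) = (-1) ^+ j * cross p q.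
Proof.
elim: j p q => /= [p q|j IH p q]; first by rewrite mul1r.
by rewrite IH cross_reflect ?edge_neq0// exprS; ring.
Qed.

Lemma lframe_pscale w j (c : R) f : lframe w j (pscale c f) = pscale c (lframe w j f).
Proof. by elim: j f => //= j IH f; rewrite reflect_pscale IH. Qed.

Lemma frame_add w j k p : frame w (j + k) p = frame w j (frame (fun l => w (j + l)%N) k p).
Proof.
by elim: k p => [|k IH] p; rewrite ?addn0// addnS /= IH -addnS.
Qed.

Lemma eq_frame w w' j p : (forall l, (0 < l <= j)%N -> w l = w' l) -> frame w j p = frame w' j p.
Proof.
elim: j p => //= j IH p e; rewrite e ?leqnn// IH// => l /andP[l0 lj].
by rewrite e// l0 leqW.
Qed.

Definition trajectory w P : Prop :=
  [/\ forall j, in_side (w j) (P j), forall j, w j != w j.+1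
   & forall j, exists lam : R, 0 < lam /\
       psub (P j.+2) (P j.+1) = pscale lam (mirror (edge (w j.+1)) (psub (P j.+1) (P j)))].

Definition unfolded w P j := frame w j (P j).
(** In copy [j], the vertex facing the side [w j] of entry: the ray passes it on the left or on the
    right. *)
Definition apex w j := frame w j (v (w j)).
(** Odd copies are mirror images, so the parity converts the choice between the two remaining sides
    into a planar one: true when the apex lies to the left of the ray. *)
Definition turn w j := (w j.+1 == ordS (w j)) (+) odd j.

Section OneTrajectory.
Variables (w : nat -> 'I_3) (P : nat -> point R).
Hypothesis wP : trajectory w P.

Lemma unfolded_step j : psub (unfolded w P j.+1) (unfolded w P j) =
  lframe w j (psub (P j.+1) (P j)).
Proof.
have [ons _ _] := wP.
by rewrite /unfolded /= (fold_fix_side (ons j.+1)) frame_psub.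
Qed.

Lemma velocity_cross j :
  (if w j.+1 == ordS (w j) then 0 < cross (psub (P j.+1) (P j)) (psub (v (w j)) (P j))
   else cross (psub (P j.+1) (P j)) (psub (v (w j)) (P j)) < 0).
Proof.
have [ons ww _] := wP.
have [e|e|e] := ord3P (w j) (w j.+1).
- by have := ww j; rewrite e eqxx.
- by rewrite e eqxx cross_next// -e.
- have /negPf -> : w j.+1 != ordS (w j) by rewrite e ordS_neq.
  by rewrite cross_prev// -e.
Qed.

Lemma velocity_neq0 j : psub (P j.+1) (P j) <> (0, 0).
Proof.
move=> e; have := velocity_cross j; rewrite e /cross /= !mul0r subrr ltxx.
by case: ifP.
Qed.

(** The reflection law cancels the mirror that each crossing adds to the frame, so all unfolded
    displacements keep the initial direction. *)
Lemma unfolded_straight : exists (d : point R) (len : nat -> R),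
  dot d d = 1 /\ forall j, 0 < len j /\
    psub (unfolded w P j.+1) (unfolded w P j) = pscale (len j) d.
Proof.
have [ons ww law] := wP.
pose f0 := psub (P 1%N) (P 0%N).
have n0 : 0 < dot f0 f0.
  rewrite lt0r dot_ge0 andbT /dot -!expr2 paddr_eq0 ?sqr_ge0// !sqrf_eq0.
  apply/negP => /andP[/eqP e1 /eqP e2]; apply: (@velocity_neq0 0).
  by rewrite -/f0; case: (f0) e1 e2 => /= ? ? -> ->.
pose r := Num.sqrt (dot f0 f0).
have r0 : 0 < r by rewrite sqrtr_gt0.
have main j : exists l : R, 0 < l /\
   psub (unfolded w P j.+1) (unfolded w P j) = pscale l (pscale r^-1 f0).
  elim: j => [|j [l [l0 IH]]].
    exists r; split=> //; rewrite unfolded_step /= -/f0 /pscale /= !mulrA divff ?gt_eqF//.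
    by rewrite !mul1r.
  have [lam [lam0 e]] := law j; exists (lam * l); split; first exact: mulr_gt0.
  rewrite unfolded_step e lframe_pscale /= reflectK ?edge_neq0// -unfolded_step IH.
  by rewrite /pscale /= !mulrA.
have [len hlen] := choice main.
exists (pscale r^-1 f0), len; split=> //.
rewrite dotZ (_ : dot _ _ = r^-1 * dot f0 f0); last by rewrite /dot /=; ring.
by rewrite mulrA -expr2 exprVn sqr_sqrtr ?ltW// mulVf ?gt_eqF.
Qed.

End OneTrajectory.

(** The [y l] are points of a line at distance one from a vertex, seen from it under successive
    angles of sine at least [s]. This forces gaps of at least [s], and puts the inner points within
    [1 / s] of the origin. *)
Lemma fan_bound (s : R) (y : nat -> R) N : 0 < s ->
  (forall l, (l <= N)%N -> y l < y l.+1 /\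
     s ^+ 2 * ((1 + y l ^+ 2) * (1 + y l.+1 ^+ 2)) <= (y l.+1 - y l) ^+ 2) ->
  N%:R <= 1 + 2 / s ^+ 2.
Proof.
move=> s0 H.
have s20 : 0 < s ^+ 2 by rewrite exprn_gt0.
have bnd (a b : R) : 0 < a -> 0 <= b -> s ^+ 2 * (b * a) <= a -> b <= s ^- 2.
  move=> a0 b0; rewrite mulrA -[leRHS]mul1r ler_pM2r// => h.
  by rewrite -[s ^- 2]mul1r ler_pdivlMr// mulrC.
have bd l : (l < N)%N -> y l.+1 ^+ 2 <= s ^- 2.
  move=> lN; have [h1 h2] := H _ (ltnW lN); have [h3 h4] := H _ lN.
  (* The step on the far side from the origin is used: its length is at most the absolute value of
     its far endpoint. *)
  have [y0|y0] := leP 0 (y l.+1).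
    apply: (bnd ((y l.+2 - y l.+1) ^+ 2)); rewrite ?sqr_ge0 ?exprn_gt0 ?subr_gt0//.
    apply: le_trans h4; rewrite ler_pM2l//.
    apply: ler_pM; rewrite ?sqr_ge0 ?lerDr//.
    rewrite (le_trans (y := y l.+2 ^+ 2)) ?lerDr// ler_sqr ?nnegrE; lra.
  apply: (bnd ((y l.+1 - y l) ^+ 2)); rewrite ?sqr_ge0 ?exprn_gt0 ?subr_gt0//.
  apply: le_trans h2; rewrite ler_pM2l// mulrC.
  apply: ler_pM; rewrite ?sqr_ge0 ?lerDr//.
  rewrite (le_trans (y := y l ^+ 2)) ?lerDr// -[leRHS]sqrrN ler_sqr ?nnegrE; lra.
have st l : (l <= N)%N -> s <= y l.+1 - y l.
  move=> lN; have [h1 h2] := H _ lN.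
  rewrite -ler_sqr ?nnegrE; [|exact: ltW|by rewrite subr_ge0 ltW].
  apply: le_trans h2.
  rewrite ler_peMr ?sqr_ge0//; have := sqr_ge0 (y l); have := sqr_ge0 (y l.+1).
  nra.
case: N => [|N] in H bd st *.
  by rewrite ler_wpDr// divr_ge0// ltW.
have inc l : (l <= N)%N -> l%:R * s <= y l.+1 - y 1%N.
  elim: l => [_|l IH lN]; first by rewrite mul0r subrr.
  have := IH (ltnW lN); have := st l.+1 (leqW lN).
  by rewrite -natr1 mulrDl mul1r; lra.
have abs l : (l <= N)%N -> `|y l.+1| <= s^-1.
  by move=> /bd h; apply: normr_sqr_le; [rewrite invr_ge0 ltW|rewrite exprVn].
have := inc N (leqnn _); have := abs N (leqnn _); have := abs 0%N (leq0n _).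
rewrite !ler_norml => /andP[h1 _] /andP[_ h2] h3.
rewrite -natr1 addrC lerD2l ler_pdivlMr// expr2 mulrA.
by rewrite -ler_pdivlMr//; lra.
Qed.

(** * Distance travelled along a ray *)

Variable M : R.
Hypothesis M_gt0 : 0 < M.
Hypothesis vM : forall k, `|(v k).1| <= M /\ `|(v k).2| <= M.
(** A bound for the diameter: each coordinate varies by at most [2 * M], and 4 + 4 is less than
    9. *)
Let D := 3 * M.

Let D_gt0 : 0 < D. Proof. by rewrite mulr_gt0. Qed.

Lemma in_side_bounded i p : in_side i p -> `|p.1| <= M /\ `|p.2| <= M.
Proof.
move=> [t [t0 [t1 ->]]] /=; have [a1 a2] := vM (ordS i); have [b1 b2] := vM (ordS (ordS i)).
by split; rewrite (le_trans (ler_normD _ _))// !normrM (gtr0_norm t0) gtr0_norm ?subr_gt0//; nra.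
Qed.

Lemma bounded_diam p q : `|p.1| <= M /\ `|p.2| <= M -> `|q.1| <= M /\ `|q.2| <= M ->
  dot (psub p q) (psub p q) <= D ^+ 2.
Proof.
rewrite !ler_norml => -[/andP[? ?] /andP[? ?]] [/andP[? ?] /andP[? ?]].
have := M_gt0; rewrite /dot /D /= => M0.
have h (x : R) : - (2 * M) <= x <= 2 * M -> x * x <= 4 * M ^+ 2.
  by move=> /andP[? ?]; nra.
have := h (p.1 - q.1); have := h (p.2 - q.2).
by move=> /(_ _)/wrap[]; [lra|]; move=> ? /(_ _)/wrap[]; [lra|]; nra.
Qed.

Definition straight w P d (len : nat -> R) : Prop := dot d d = 1 /\ forall j, 0 < len j /\
    psub (unfolded w P j.+1) (unfolded w P j) = pscale (len j) d.

Section Straight.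
Variables (w : nat -> 'I_3) (P : nat -> point R) (d : point R) (len : nat -> R).
Hypothesis wP : trajectory w P.
Hypothesis line : straight w P d len.

(** Arc length along the ray from its start to crossing [j]. *)
Definition tau j := dot d (psub (unfolded w P j) (P 0%N)).

Lemma tauS j : tau j.+1 = tau j + len j.
Proof.
have [d1 ld] := line; have [_ e] := ld j.
rewrite /tau (psub_telescope _ (unfolded w P j)) e dotDr dotZ d1; ring.
Qed.

Lemma unfolded_on_line j : cross d (psub (unfolded w P j) (P 0%N)) = 0.
Proof.
have [d1 ld] := line; elim: j => [|j IH].
  by rewrite /unfolded /= /cross /=; ring.
have [_ e] := ld j.
by rewrite (psub_telescope _ (unfolded w P j)) e crossDr crossZr crossxx IH mulr0 addr0.
Qed.

Lemma len_sqr j : len j ^+ 2 = dot (psub (P j.+1) (P j)) (psub (P j.+1) (P j)).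
Proof.
have [d1 ld] := line; have [_ e] := ld j.
rewrite -(dot_lframe w j) -(unfolded_step wP) e.
rewrite dotZ (_ : dot _ _ = len j * dot d d); last by rewrite /dot /=; ring.
by rewrite d1 mulr1 expr2.
Qed.

Lemma len_le j : len j <= D.
Proof.
have [ons _ _] := wP; have [l0 _] := line.2 j.
rewrite -ler_sqr ?nnegrE; [|exact: ltW|exact: ltW]; rewrite len_sqr.
by apply: bounded_diam; apply: in_side_bounded (ons _).
Qed.

Lemma tau_bound j : 0 <= tau j <= j%:R * D.
Proof.
elim: j => [|j IH].
  by rewrite /tau /unfolded /= mul0r /dot /= !subrr !mulr0 addr0 lexx.
rewrite tauS -natr1; have := len_le j; have [] := line.2 j; lra.
Qed.

Lemma tau_mono j k : (j <= k)%N -> tau j <= tau k.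
Proof.
move/subnK <-; elim: (k - j)%N => [|l IH]; first by rewrite add0n.
by rewrite addSn tauS (le_trans IH)// lerDl ltW//; have [] := line.2 (l + j)%N.
Qed.

Lemma height_le i j p q : in_side i p -> dot (psub q p) (psub q p) = len j ^+ 2 ->
  height i q <= D * len j.
Proof.
move=> ps e; rewrite (height_side _ ps); apply: le_trans (ler_norm _) _.
have [l0 _] := line.2 j.
apply: normr_sqr_le; first by rewrite mulr_ge0 ?ltW.
apply: (@le_trans _ _ (dot (edge i) (edge i) * dot (psub q p) (psub q p))).
  by rewrite -lagrange lerDl sqr_ge0.
by rewrite e exprMn ler_pM2r ?exprn_gt0// bounded_diam.
Qed.

(** Three different sides are hit. At the middle point one height vanishes; the other two, whose sum
    is [A], are at most [D] times the adjacent step lengths. *)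
Lemma two_steps_lb j : w j.+2 != w j -> A <= D * (len j + len j.+1).
Proof.
have [ons ww _] := wP; have := ww j; have := ww j.+1 => n1 n2 n3.
have h1 := height_le (ons j) (esym (len_sqr j)).
have h2 : height (w j.+2) (P j.+1) <= D * len j.+1.
  apply: (height_le (ons j.+2)); rewrite len_sqr.
  by rewrite /dot /=; ring.
have h0 := height_side0 (ons j.+1).
have := height_sum (w j) (P j.+1).
have [e1|e1|e1] := ord3P (w j) (w j.+1); first by rewrite e1 eqxx in n2.
  have [e2|e2|e2] := ord3P (w j) (w j.+2); [by rewrite e2 eqxx in n3|by rewrite e1 e2 eqxx in n1|].
  by rewrite -e2 -e1; lra.
have [e2|e2|e2] := ord3P (w j) (w j.+2); [by rewrite e2 eqxx in n3| |by rewrite e1 e2 eqxx in n1].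
by rewrite -e1 -e2; lra.
Qed.

(** While the letters alternate, the trajectory circles one vertex, fixed by all the folds.
    Successive spokes at this vertex make angles of sine at least [A / D ^+ 2], so [fan_bound]
    limits their number. *)
Lemma fan_short j N : (forall l, (l <= N)%N -> w (j + l).+2 = w (j + l)%N) ->
  N%:R <= 1 + 2 / (A / D ^+ 2) ^+ 2.
Proof.
move=> fan; have [ons ww _] := wP; have [d1 ld] := line.
have [k kj kj1] : exists2 k, k != w j & k != w j.+1.
  have := ww j; have [->|->|->] := ord3P (w j) (w j.+1); rewrite ?eqxx// => _.
    by exists (ordS (ordS (w j))); rewrite ?ordSS_neq ?ordS_neq.
  by exists (ordS (w j)); rewrite ?ordS_neq// eq_sym ordS_neq.
have kn l : (l <= N.+2)%N -> k != w (j + l)%N.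
  have [m] := ubnP l; elim: m l => // m IH [|[|l]] lm lN; rewrite ?addn0 ?addn1//.
  by rewrite !addnS fan// IH//; lia.
pose V := frame w j (v k).
have VE l : (l <= N.+2)%N -> frame w (j + l) (v k) = V.
  elim: l => [|l IH] lN; first by rewrite addn0.
  rewrite addnS /= fold_fix_vertex; first exact: IH (ltnW lN).
  by rewrite -addnS kn.
(* [h] and [x l] are the coordinates, across and along the ray, of the crossings relative to the
   vertex [V]. *)
pose h := cross d (psub (P 0%N) V).
have hE l : cross d (psub (unfolded w P l) V) = h.
  by rewrite (psub_telescope _ (P 0%N)) crossDr unfolded_on_line add0r.
pose x l := dot d (psub (unfolded w P (j + l)) V).
have xS l : x l.+1 = x l + len (j + l).
  have [_ e] := ld (j + l)%N.
  rewrite /x addnS (psub_telescope _ (unfolded w P (j + l))) e dotDr dotZ d1; ring.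
have main l : (l <= N)%N -> h != 0 /\
   (A / D ^+ 2) ^+ 2 * ((x l ^+ 2 + h ^+ 2) * (x l.+1 ^+ 2 + h ^+ 2)) <= (h * len (j + l)) ^+ 2.
  move=> lN.
  have nn : w (j + l)%N != w (j + l).+1 by [].
  have kl : k != w (j + l)%N by apply: kn; rewrite (leq_trans lN) ?leqW.
  have kl1 : k != w (j + l).+1 by rewrite -addnS; apply: kn; rewrite ltnS leqW.
  have [r [s [r0 s0 crE [a pE] [b qE]]]] := fan_cross nn kl kl1 (ons _) (ons _).
  have e1 : psub (unfolded w P (j + l)) V = lframe w (j + l) (psub (P (j + l)%N) (v k)).
    by rewrite -frame_psub VE// (leq_trans lN) ?leqW.
  have e2 : psub (unfolded w P (j + l).+1) V = lframe w (j + l) (psub (P (j + l).+1) (v k)).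
    rewrite -frame_psub /unfolded /= fold_fix_side//.
    by rewrite VE// (leq_trans lN) ?leqW.
  have crE2 : (h * len (j + l)) ^+ 2 = (r * s * A) ^+ 2.
    rewrite -crE -[RHS]mul1r -(sqrr_sign R (odd (j + l))) signr_odd -exprMn -(cross_lframe w).
    rewrite -e1 -e2 (cross_unit _ _ d1) !hE -addnS -!/(x _) xS -[RHS]sqrrN; congr (_ ^+ 2); ring.
  have dl z1 z2 : dot (psub (v z1) (v z2)) (psub (v z1) (v z2)) <= D ^+ 2 by apply: bounded_diam.
  have b1 : x l ^+ 2 + h ^+ 2 <= r ^+ 2 * D ^+ 2.
    rewrite -(hE (j + l)%N) -dot_unit// e1 dot_lframe pE dotZ.
    rewrite (_ : dot (pscale _ _) _ = r * dot (psub (v a) (v k)) (psub (v a) (v k))); last by rewrite /dot /=; ring.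
    by rewrite mulrA -expr2 ler_pM2l ?exprn_gt0.
  have b2 : x l.+1 ^+ 2 + h ^+ 2 <= s ^+ 2 * D ^+ 2.
    rewrite -(hE (j + l.+1)%N) /x addnS -dot_unit// e2 dot_lframe qE dotZ.
    rewrite (_ : dot (pscale _ _) _ = s * dot (psub (v b) (v k)) (psub (v b) (v k))); last by rewrite /dot /=; ring.
    by rewrite mulrA -expr2 ler_pM2l ?exprn_gt0.
  split.
    apply/eqP => h0; move: crE2; rewrite h0 mul0r expr0n /= => /esym/eqP.
    by rewrite sqrf_eq0 !mulf_eq0 !gt_eqF.
  rewrite crE2.
  apply: (@le_trans _ _ ((A / D ^+ 2) ^+ 2 * ((r ^+ 2 * D ^+ 2) * (s ^+ 2 * D ^+ 2)))).
    rewrite ler_pM2l ?exprn_gt0 ?divr_gt0 ?exprn_gt0//.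
    by apply: ler_pM => //; rewrite addr_ge0 ?sqr_ge0.
  rewrite le_eqVlt; apply/orP; left; apply/eqP.
  have D0 : D != 0 by rewrite gt_eqF.
  by field.
have h0 : h != 0 by have [] := main 0%N (leq0n _).
have nh0 : 0 < `|h| by rewrite normr_gt0.
(* The distance from [V] to the ray is normalised to one. *)
apply: (@fan_bound _ (fun l => x l / `|h|)).
  by rewrite divr_gt0 ?exprn_gt0.
move=> l lN; have [_ ml] := main l lN; have [l0 _] := ld (j + l)%N.
split; first by rewrite ltr_pM2r ?invr_gt0// xS ltrDl.
rewrite -mulrBl xS (_ : x l + _ - _ = len (j + l)); last by ring.
rewrite -(ler_pM2r (exprn_gt0 4 nh0)).
have hh : h ^+ 2 = `|h| ^+ 2 by rewrite real_normK// num_real.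
have n0 : `|h| != 0 by rewrite gt_eqF.
move: ml; rewrite [leRHS]exprMn hh xS.
set H := `|h| in n0 *; set X := x l; set L := len _; set S := (A / _) ^+ 2.
rewrite -(_ : (L / H) ^+ 2 * H ^+ 4 = H ^+ 2 * L ^+ 2); last by field.
by congr (_ <= _); field.
Qed.

End Straight.

(** Every [N.+2] steps contain two that meet three different sides, for otherwise a fan would be too
    long; such a stretch advances the ray by at least [A / D]. The total [3 * D] leaves a margin
    over the distance, at most [D], of an apex from its crossing at each end. *)
Lemma travel_lb : exists K : nat, (0 < K)%N /\ forall w P d len,
  trajectory w P -> straight w P d len -> forall j,
  3 * D <= tau w P d (j + K) - tau w P d j.
Proof.
set c : R := 1 + 2 / (A / D ^+ 2) ^+ 2.
have c0 : 0 <= c by rewrite addr_ge0// divr_ge0// sqr_ge0.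
pose N := (Num.truncn c).+1.
have cN : c < N%:R by apply: truncnS_gt.
pose q := (Num.truncn (3 * D / (A / D))).+1.
have qN : 3 * D / (A / D) < q%:R by apply: truncnS_gt.
have AD : 0 < A / D by rewrite divr_gt0.
exists (N.+2 * q)%N; split; first by rewrite muln_gt0.
move=> w P d len wP line.
have step j : A / D <= tau w P d (j + N.+2) - tau w P d j.
  have [l lN nl] : exists2 l, (l <= N)%N & w (j + l).+2 != w (j + l)%N.
    apply: contrapT => H; have := fan_short wP line (j := j) (N := N).
    rewrite leNgt cN => /(_ _)/negP; apply => // l lN; apply/eqP/negPn/negP => nl.
    by apply: H; exists l.
  have := two_steps_lb wP line nl; rewrite -ler_pdivrMl// mulrC => /le_trans; apply.
  have h1 : tau w P d j <= tau w P d (j + l) by apply: (tau_mono line); clear -lN; lia.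
  have h2 : tau w P d (j + l).+2 <= tau w P d (j + N.+2) by apply: (tau_mono line); clear -lN; lia.
  have := tauS line (j + l); have := tauS line (j + l).+1; lra.
move=> j; move: qN; rewrite ltr_pdivrMr// => /ltW/le_trans; apply.
elim: q => [|q IH]; first by rewrite muln0 addn0 mul0r subrr.
have := step (j + N.+2 * q)%N; rewrite -addnA -mulnSr; move: IH.
by rewrite -natr1 mulrDl mul1r; lra.
Qed.

(** * Apexes near a ray and their collinearity *)

Definition billiard_ray w P d := trajectory w P /\ exists len, straight w P d len.

(** [offset] and [advance] are the coordinates of the apex across the ray, positive on the left, and
    along it. *)
Definition offset w P d j := cross d (psub (apex w j) (P 0%N)).
Definition advance w P d j := dot d (psub (apex w j) (P 0%N)).

(** Multiplied by the step length, the offset becomes a cross product in the original triangle with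
    the sign [(-1) ^+ j], which the parity in [turn] cancels. *)
Lemma turn_offset w P d j : billiard_ray w P d ->
  if turn w j then 0 < offset w P d j else offset w P d j < 0.
Proof.
move=> [wP [len line]]; have [d1 ld] := line; have [l0 e] := ld j.
have E : len j * offset w P d j = (-1) ^+ j * cross (psub (P j.+1) (P j)) (psub (v (w j)) (P j)).
  rewrite /offset (psub_telescope _ (unfolded w P j)) crossDr.
  rewrite (unfolded_on_line line) addr0 -crossZl -e (unfolded_step wP).
  by rewrite /apex /unfolded frame_psub cross_lframe.
have := velocity_cross wP j.
rewrite -(pmulr_rgt0 (offset w P d j) l0) -(pmulr_rlt0 (offset w P d j) l0) E /turn.
rewrite -signr_odd; case: (odd j); rewrite ?expr1 ?expr0 ?mul1r ?mulN1r ?oppr_gt0 ?oppr_lt0;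
  by case: ifP.
Qed.

Lemma apex_near w P d j : billiard_ray w P d ->
  dot (psub (apex w j) (unfolded w P j)) (psub (apex w j) (unfolded w P j)) <= D ^+ 2.
Proof.
move=> [wP _]; have [ons _ _] := wP.
by rewrite frame_psub dot_lframe bounded_diam//; apply: in_side_bounded (ons j).
Qed.

Lemma advance_near w P d len j : trajectory w P -> straight w P d len ->
  tau w P d j - D <= advance w P d j <= tau w P d j + D.
Proof.
move=> wP line; have ray : billiard_ray w P d by split=> //; exists len.
rewrite /advance (psub_telescope _ (unfolded w P j)) dotDr -/(tau w P d j).
have := dot_le_unit (ltW D_gt0) line.1 (apex_near j ray).
by rewrite ler_norml => /andP[]; lra.
Qed.

(** Both rays have the same apex, whose coordinates relative to the start are at most [j.+1 * D]. A
    change of direction is multiplied by this, a change of start only by the unit vector [d']. *)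
Lemma offset_near w P d j w' P' d' (e : R) : 0 <= e ->
  billiard_ray w P d -> billiard_ray w' P' d' -> (apex w' j = apex w j) ->
  `|d.1 - d'.1| <= e -> `|d.2 - d'.2| <= e ->
  `|(P 0%N).1 - (P' 0%N).1| <= e -> `|(P 0%N).2 - (P' 0%N).2| <= e ->
  `|offset w P d j - offset w' P' d' j| <= 2 * e * (j.+1%:R * D + 1).
Proof.
move=> e0 ray [w'P' [len' line']] aE h1 h2 h3 h4.
have [wP [len line]] := ray.
have [a1 a2] := coord_le_dot (ltW D_gt0) (apex_near j ray).
have [b1 b2] : `|(psub (unfolded w P j) (P 0%N)).1| <= j%:R * D /\ `|(psub (unfolded w P j) (P 0%N)).2| <= j%:R * D.
  have /andP[t0 tD] := tau_bound wP line j.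
  apply: coord_le_dot; first exact: le_trans t0 tD.
  rewrite (dot_unit _ line.1) (unfolded_on_line line) expr0n addr0 /= -/(tau w P d j).
  by rewrite ler_sqr ?nnegrE//; exact: le_trans t0 tD.
have [d1 d2] : `|d'.1| <= 1 /\ `|d'.2| <= 1.
  by apply: coord_le_dot => //; rewrite line'.1 expr1n.
rewrite /offset aE (_ : _ - _ =
  (d.1 - d'.1) * (psub (apex w j) (P 0%N)).2 - (d.2 - d'.2) * (psub (apex w j) (P 0%N)).1
  - d'.1 * ((P 0%N).2 - (P' 0%N).2) + d'.2 * ((P 0%N).1 - (P' 0%N).1)); last first.
  by rewrite /cross /psub /=; ring.
have c1 : `|(psub (apex w j) (P 0%N)).1| <= j.+1%:R * D.
  rewrite (psub_telescope _ (unfolded w P j)) -natr1 mulrDl mul1r addrC /=.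
  by rewrite (le_trans (ler_normD _ _))// lerD.
have c2 : `|(psub (apex w j) (P 0%N)).2| <= j.+1%:R * D.
  rewrite (psub_telescope _ (unfolded w P j)) -natr1 mulrDl mul1r addrC /=.
  by rewrite (le_trans (ler_normD _ _))// lerD.
have mul (x y a b : R) : `|x| <= a -> `|y| <= b -> `|x * y| <= a * b.
  by move=> xa yb; rewrite normrM ler_pM.
have m1 := mul _ _ _ _ h1 c2; have m2 := mul _ _ _ _ h2 c1.
have m3 := mul _ _ _ _ d1 h4; have m4 := mul _ _ _ _ d2 h3.
rewrite !ler_norml in m1 m2 m3 m4 *.
move: m1 m2 m3 m4 => /andP[? ?] /andP[? ?] /andP[? ?] /andP[? ?].
by apply/andP; split; lra.
Qed.

Lemma eq_apex w w' j : (forall l, (l <= j)%N -> w l = w' l) -> apex w j = apex w' j.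
Proof. by move=> e; rewrite /apex e//; apply: eq_frame => l /andP[_]; exact: e. Qed.

(** The collinearity determinant of three vertices, in the initial triangle and in copies [k] and
    [l]. *)
Definition vertex_cross w k l (a b c : 'I_3) :=
  cross (psub (frame w k (v b)) (v a)) (psub (frame w l (v c)) (v a)).

(** Undoing the isometry [frame w n] restarts the unfolding at step [n]. The determinant thus
    depends only on the letters from there on, and its degree on the length of a block rather than
    of the whole word. *)
Lemma apex_cross w n k l : `|cross (psub (apex w (n + k)) (apex w n)) (psub (apex w (n + l)) (apex w n))| =
  `|vertex_cross (fun j => w (n + j)%N) k l (w n) (w (n + k)%N) (w (n + l)%N)|.
Proof.
by rewrite /apex !frame_add !frame_psub cross_lframe normrM normrX normrN1 expr1n mul1r.
Qed.

(* The part of the ray beyond V2 of the line through V1 and V2 lies on the same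
   side as V2, whereas V1 lies on the other side. *)
Lemma beyond_crossing (t1 t2 t3 c1 c2 c3 : R) : t1 < t2 -> t2 < t3 ->
  (t2 - t1) * (c3 - c1) - (c2 - c1) * (t3 - t1) = 0 ->
  0 < c1 -> c2 < 0 -> c3 < 0.
Proof.
move=> h1 h2 e p1 p2.
have t0 : 0 < t2 - t1 by rewrite subr_gt0.
rewrite -(pmulr_rlt0 _ t0) (_ : _ * _ = c1 * (t2 - t3) + c2 * (t3 - t1)); last by lra.
by nra.
Qed.

Definition near_rays (e : R) (r r' : (nat -> 'I_3) * (nat -> point R) * point R) :=
  [/\ `|r.2.1 - r'.2.1| <= e, `|r.2.2 - r'.2.2| <= e,
      `|(r.1.2 0%N).1 - (r'.1.2 0%N).1| <= e & `|(r.1.2 0%N).2 - (r'.1.2 0%N).2| <= e].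

(** The two witnesses pass the common apex on opposite sides, and both offsets are close to that of
    [w], which is therefore close to zero. *)
Lemma split_offset (e : R) w P d j n w1 P1 d1 w2 P2 d2 : 0 <= e -> (j < n)%N ->
  billiard_ray w P d -> billiard_ray w1 P1 d1 -> billiard_ray w2 P2 d2 ->
  near_rays e (w1, P1, d1) (w, P, d) -> near_rays e (w2, P2, d2) (w, P, d) ->
  (forall l, (l <= j)%N -> w l = w1 l) -> (forall l, (l <= j)%N -> w l = w2 l) ->
  turn w1 j != turn w2 j -> `|offset w P d j| <= 2 * e * (n%:R * D + 1).
Proof.
move=> e0 jn r r1 r2 [/= a1 a2 a3 a4] [/= b1 b2 b3 b4] e1 e2 ne.
have n1 := offset_near e0 r1 r (eq_apex e1) a1 a2 a3 a4.
have n2 := offset_near e0 r2 r (eq_apex e2) b1 b2 b3 b4.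
have := turn_offset j r1; have := turn_offset j r2.
have : 2 * e * (j.+1%:R * D + 1) <= 2 * e * (n%:R * D + 1).
  by rewrite ler_wpM2l ?mulr_ge0// lerD2r ler_pM2r// ler_nat.
move: n1 n2 ne; rewrite !ler_norml => /andP[? ?] /andP[? ?].
by case: (turn w1 j); case: (turn w2 j) => // _ ? ? ?; apply/andP; split; lra.
Qed.

Variables (K : nat).
Hypothesis K_travel : forall w P d len, trajectory w P -> straight w P d len ->
  forall j, 3 * D <= tau w P d (j + K) - tau w P d j.

Lemma advance_mono w P d (i j : nat) : billiard_ray w P d -> (i + K <= j)%N ->
  advance w P d i < advance w P d j.
Proof.
move=> [wP [len line]] ij.
have /andP[_ h1] := advance_near i wP line; have /andP[h2 _] := advance_near j wP line.
have := K_travel wP line i; have := tau_mono line ij; have := D_gt0; lra.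
Qed.

(** The three apexes lie so close to the ray that their determinant is below the gap, hence zero. If
    [w] passed the first two on different sides, both [w] and [w'] would cross the common line
    between them and then pass the third on the same side as the second, against the split there. *)
Lemma no_split_beyond_crossing (e del : R) n m w P d w' P' d'
    w1 P1 d1 w1' P1' d1' w2 P2 d2 w2' P2' d2' j1 j2 j3 : 0 <= e ->
  (forall w k l a b c, (k <= l)%N -> (l <= m)%N ->
     vertex_cross w k l a b c = 0 \/ del <= `|vertex_cross w k l a b c|) ->
  8 * (n.+1%:R * D) * (e * (n%:R * D + 1)) < del ->
  (j1 + K <= j2)%N -> (j2 + K <= j3)%N -> (j3 - j1 <= m)%N -> (j3 < n)%N ->
  billiard_ray w P d -> billiard_ray w' P' d' ->
  billiard_ray w1 P1 d1 -> billiard_ray w1' P1' d1' ->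
  billiard_ray w2 P2 d2 -> billiard_ray w2' P2' d2' ->
  near_rays e (w', P', d') (w, P, d) -> near_rays e (w, P, d) (w, P, d) ->
  near_rays e (w1, P1, d1) (w, P, d) -> near_rays e (w1', P1', d1') (w, P, d) ->
  near_rays e (w2, P2, d2) (w, P, d) -> near_rays e (w2', P2', d2') (w, P, d) ->
  (forall l, (l <= j3)%N -> w l = w' l) ->
  (forall l, (l <= j1)%N -> w l = w1 l) -> (forall l, (l <= j1)%N -> w l = w1' l) ->
  (forall l, (l <= j2)%N -> w l = w2 l) -> (forall l, (l <= j2)%N -> w l = w2' l) ->
  turn w1 j1 != turn w1' j1 -> turn w2 j2 != turn w2' j2 -> turn w j3 != turn w' j3 ->
  turn w' j1 = turn w j1 -> turn w' j2 = turn w j2 ->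
  turn w j1 = turn w j2.
Proof.
move=> e0 gap small j12 j23 j13m j3n.
have [le12 le23 le13 lt1n [lt2n lekl]] : [/\ (j1 <= j2)%N, (j2 <= j3)%N, (j1 <= j3)%N,
  (j1 < n)%N & (j2 < n)%N /\ (j2 - j1 <= j3 - j1)%N] by split; [lia..|split; lia].
move=> r r' r1 r1' r2 r2' n' n0 n1 n1' n2 n2'.
move=> a' a1 a1' a2 a2' t1 t2 t3 tE1 tE2.
have o1 := split_offset e0 lt1n r r1 r1' n1 n1' a1 a1' t1.
have o2 := split_offset e0 lt2n r r2 r2' n2 n2' a2 a2' t2.
have o3 := split_offset e0 j3n r r r' n0 n' (fun _ _ => erefl) a' t3.
have [wP [len line]] := r; have dd1 := line.1.
pose X := cross (psub (apex w j2) (apex w j1)) (psub (apex w j3) (apex w j1)).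
have XE w0 P0 d0 : billiard_ray w0 P0 d0 -> apex w0 j1 = apex w j1 -> apex w0 j2 = apex w j2 ->
    apex w0 j3 = apex w j3 ->
    X = (advance w0 P0 d0 j2 - advance w0 P0 d0 j1) * (offset w0 P0 d0 j3 - offset w0 P0 d0 j1)
     - (offset w0 P0 d0 j2 - offset w0 P0 d0 j1) * (advance w0 P0 d0 j3 - advance w0 P0 d0 j1).
  move=> [_ [len0 line0]] e1 e2 e3.
  rewrite /X (cross_unit _ _ line0.1) /advance /offset e1 e2 e3 /cross /dot /psub /=; ring.
have X0 : X = 0.
  have := gap (fun j => w (j1 + j)%N) _ _ (w j1) (w j2) (w j3) lekl j13m.
  have := apex_cross w j1 (j2 - j1) (j3 - j1).
  rewrite !subnKC//; rewrite -/X => XV [X0|].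
    by apply/eqP; rewrite -normr_eq0 XV X0 normr0.
  rewrite -XV => dX; exfalso; move: dX; apply/negP; rewrite -ltNge; apply: le_lt_trans small.
  rewrite (XE _ _ _ r)//.
  have adv j : (j < n)%N -> - D <= advance w P d j <= n%:R * D.
    move=> jn; have /andP[h1 h2] := advance_near j wP line.
    have /andP[h3 h4] := tau_bound wP line j.
    have : j.+1%:R * D <= n%:R * D by rewrite ler_pM2r// ler_nat.
    by rewrite -natr1 mulrDl mul1r; lra.
  have /andP[p1 q1] := adv j1 lt1n; have /andP[p2 q2] := adv j2 lt2n.
  have /andP[p3 q3] := adv j3 j3n.
  have nE : n.+1%:R * D = n%:R * D + D by rewrite -natr1 mulrDl mul1r.
  have mul (x y a b : R) : `|x| <= a -> `|y| <= b -> `|x * y| <= a * b.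
    by move=> xa yb; rewrite normrM ler_pM.
  have B j j' : (j < n)%N -> (j' < n)%N -> `|advance w P d j - advance w P d j'| <= n.+1%:R * D.
    move=> /adv/andP[? ?] /adv/andP[? ?]; rewrite nE ler_norml; apply/andP; split; lra.
  have C (x y a : R) : `|x| <= a -> `|y| <= a -> `|x - y| <= 2 * a.
    by move=> xa ya; rewrite (le_trans (ler_normB _ _))//; lra.
  (* Each of the two products is an advance difference, at most [n.+1 * D], times an offset
     difference, at most four times [e * (n * D + 1)]; hence the factor 8. *)
  have m1 := mul _ _ _ _ (B j2 j1 lt2n lt1n) (C _ _ _ o3 o1).
  have m2 := mul _ _ _ _ (C _ _ _ o2 o1) (B j3 j1 j3n lt1n).
  rewrite (le_trans (ler_normB _ _))// (le_trans (lerD m1 m2))//.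
  by rewrite le_eqVlt; apply/orP; left; apply/eqP; ring.
have side w0 P0 d0 : billiard_ray w0 P0 d0 -> apex w0 j1 = apex w j1 -> apex w0 j2 = apex w j2 ->
    apex w0 j3 = apex w j3 -> turn w0 j1 != turn w0 j2 -> turn w0 j3 = turn w0 j2.
  move=> r0 e1 e2 e3; have := XE _ _ _ r0 e1 e2 e3; rewrite X0 => /esym E.
  have s1 := turn_offset j1 r0; have s2 := turn_offset j2 r0; have s3 := turn_offset j3 r0.
  have b1 := advance_mono r0 j12; have b2 := advance_mono r0 j23.
  case: (turn w0 j1) s1 => s1; case: (turn w0 j2) s2 => s2 // _.
    by have := beyond_crossing b1 b2 E s1 s2; case: (turn w0 j3) s3 => //; lra.
  (* The remaining case is the mirror image, with all offsets negated. *)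
  rewrite -oppr_gt0 in s1; rewrite -oppr_lt0 in s2.
  have := beyond_crossing b1 b2 (c3 := - offset w0 P0 d0 j3) _ s1 s2.
  move=> /(_ ltac:(lra)); rewrite oppr_lt0.
  by case: (turn w0 j3) s3 => //; lra.
apply/eqP/negPn/negP => ne.
have ee j : (j <= j3)%N -> apex w' j = apex w j.
  by move=> jj; apply: eq_apex => l lj; rewrite a'// (leq_trans lj).
have := side _ _ _ r erefl erefl erefl ne.
have := side _ _ _ r' (ee j1 le13) (ee j2 le23) (ee j3 (leqnn _)).
rewrite tE1 tE2 => /(_ ne) h1 h2.
by move: t3; rewrite h1 h2 eqxx.
Qed.

End Unfolding.

(** * Integer polynomials *)

Section IntegerPolynomials.
(** The inner variable ['X%:P] stands for x and the outer variable ['X] for y; degrees are bounded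
    in each variable separately. *)
Implicit Types F G : {poly {poly int}}.

Definition bidegree_le n F := (size F <= n.+1)%N /\ forall i, (size (F`_i)%R <= n.+1)%N.

Lemma bidegreeD n F G : bidegree_le n F -> bidegree_le n G -> bidegree_le n (F + G).
Proof.
move=> [h1 h2] [h3 h4]; split; first by rewrite (leq_trans (size_polyD _ _))// geq_max h1.
by move=> i; rewrite coefD (leq_trans (size_polyD _ _))// geq_max h2 h4.
Qed.

Lemma bidegreeN n F : bidegree_le n F -> bidegree_le n (- F).
Proof. by move=> [h1 h2]; split=> [|i]; rewrite ?coefN size_polyN. Qed.

Lemma bidegreeB n F G : bidegree_le n F -> bidegree_le n G -> bidegree_le n (F - G).
Proof. by move=> hF hG; apply: bidegreeD => //; apply: bidegreeN. Qed.

Lemma bidegreeW m n F : (m <= n)%N -> bidegree_le m F -> bidegree_le n F.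
Proof. by move=> mn [h1 h2]; split=> [|i]; [apply: leq_trans h1 _|apply: leq_trans (h2 i) _]. Qed.

Lemma bidegreeM m n F G : bidegree_le m F -> bidegree_le n G -> bidegree_le (m + n) (F * G).
Proof.
move=> [h1 h2] [h3 h4]; split.
  rewrite (leq_trans (size_polyMleq _ _))//; have := leq_add h1 h3; lia.
move=> i; rewrite coefM (leq_trans (size_sum _ _ _))//; apply/bigmax_leqP => j _.
rewrite (leq_trans (size_polyMleq _ _))//; have := leq_add (h2 j) (h4 (i - j)%N); lia.
Qed.

Lemma bidegree1 : bidegree_le 0 1.
Proof.
split=> [|i]; first by rewrite size_poly1.
by rewrite coef1; case: (_ == _); rewrite ?size_poly1 ?size_poly0.
Qed.

Lemma bidegreeX : bidegree_le 1 'X%:P.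
Proof.
split=> [|i]; first by rewrite (leq_trans (size_polyC_leq1 _)).
by rewrite coefC; case: (_ == _); rewrite ?size_polyX ?size_poly0.
Qed.

Lemma bidegreeY : bidegree_le 1 'X.
Proof.
split=> [|i]; first by rewrite size_polyX.
by rewrite coefX; case: (_ == _); rewrite ?size_poly1 ?size_poly0.
Qed.

Lemma bidegreeXn n k F : bidegree_le n F -> bidegree_le (n * k) (F ^+ k).
Proof.
move=> hF; elim: k => [|k IH]; first by rewrite muln0 expr0; exact: bidegree1.
by rewrite exprS mulnS; exact: bidegreeM.
Qed.

Lemma bidegree0 n : bidegree_le n 0.
Proof. by split=> [|i]; rewrite ?coef0 size_poly0. Qed.

Variables (R : realType) (x y : R).

Definition ev1 (p : {poly int}) : R := (map_poly intr p).[x].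
Definition ev F : R := (map_poly (horner_eval x \o map_poly intr) F).[y].

Lemma evD F G : ev (F + G) = ev F + ev G.
Proof. by rewrite /ev rmorphD hornerD. Qed.
Lemma evN F : ev (- F) = - ev F.
Proof. by rewrite /ev rmorphN hornerN. Qed.
Lemma evB F G : ev (F - G) = ev F - ev G.
Proof. by rewrite evD evN. Qed.
Lemma evM F G : ev (F * G) = ev F * ev G.
Proof. by rewrite /ev rmorphM hornerM. Qed.
Lemma ev_one : ev 1 = 1.
Proof. by rewrite /ev rmorph1 hornerC. Qed.
Lemma ev0 : ev 0 = 0.
Proof. by rewrite /ev rmorph0 hornerC. Qed.
Lemma evXn F n : ev (F ^+ n) = ev F ^+ n.
Proof. by elim: n => [|n IH]; rewrite ?expr0 ?ev_one// !exprS evM IH. Qed.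
Lemma evX : ev 'X%:P = x.
Proof. by rewrite /ev map_polyC hornerC /= map_polyX /horner_eval hornerX. Qed.
Lemma evY : ev 'X = y.
Proof. by rewrite /ev map_polyX hornerX. Qed.

End IntegerPolynomials.

(** * Unfolding as integer polynomials in the cotangents *)

Section PolynomialUnfolding.
Local Notation bipoly := {poly {poly int}}.
Implicit Types (P : bipoly * bipoly) (w : nat -> 'I_3) (i : 'I_3).

(** The reflections in sides 0 and 1 have denominators [1 + y ^ 2] and [1 + x ^ 2]; this is a common
    one. *)
Definition denom : bipoly := (1 + 'X%:P ^+ 2) * (1 + 'X ^+ 2).

(** The vertices times [x + y], which clears their denominators. *)
Definition pvertex i : bipoly * bipoly :=
  match val i with
  | 0 => (0, 0)
  | 1 => ('X%:P + 'X, 0)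
  | _ => ('X%:P, 1)
  end.

(* denom times the linear part of the reflection in side i, in terms of the
   cotangents 'X%:P and 'X of the angles at the vertices 0 and 1 *)
Definition pmirror i P : bipoly * bipoly :=
  match val i with
  | 0 => ((1 + 'X%:P ^+ 2) * (('X ^+ 2 - 1) * P.1 - ('X + 'X) * P.2),
          (1 + 'X%:P ^+ 2) * ((1 - 'X ^+ 2) * P.2 - ('X + 'X) * P.1))
  | 1 => ((1 + 'X ^+ 2) * (('X%:P ^+ 2 - 1) * P.1 + ('X%:P + 'X%:P) * P.2),
          (1 + 'X ^+ 2) * ((1 - 'X%:P ^+ 2) * P.2 + ('X%:P + 'X%:P) * P.1))
  | _ => (denom * P.1, - (denom * P.2))
  end.

(* A pair P at level k stands for the point P / ('X%:P + 'X) / denom ^+ k. *)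
Definition pfold i k P : bipoly * bipoly :=
  let V := pvertex (ordS i) in
  let Q := pmirror i (P.1 - denom ^+ k * V.1, P.2 - denom ^+ k * V.2) in
  (denom ^+ k.+1 * V.1 + Q.1, denom ^+ k.+1 * V.2 + Q.2).

Fixpoint pframe w j k P : bipoly * bipoly :=
  if j is j'.+1 then pframe w j' k.+1 (pfold (w j) k P) else P.

Definition pcross w k l a b c : bipoly :=
  let B := pframe w k 0 (pvertex b) in
  let C := pframe w l 0 (pvertex c) in
  (B.1 - denom ^+ k * (pvertex a).1) * (C.2 - denom ^+ l * (pvertex a).2)
  - (B.2 - denom ^+ k * (pvertex a).2) * (C.1 - denom ^+ l * (pvertex a).1).

Definition pair_bidegree_le n P := bidegree_le n P.1 /\ bidegree_le n P.2.

Lemma bidegree_X2 : bidegree_le 2 ('X%:P ^+ 2).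
Proof. exact: (bidegreeXn 2 bidegreeX). Qed.

Lemma bidegree_Y2 : bidegree_le 2 ('X ^+ 2).
Proof. exact: (bidegreeXn 2 bidegreeY). Qed.

Lemma bidegree_denom : bidegree_le 4 denom.
Proof.
have h1 := bidegreeW (leq0n 2) bidegree1.
have hX := bidegree_X2; have hY := bidegree_Y2.
by apply: (@bidegreeM 2 2); apply: bidegreeD.
Qed.

Lemma bidegree_vertex i : pair_bidegree_le 1 (pvertex i).
Proof.
have h1 := bidegreeW (leq0n 1) bidegree1; have h0 := bidegree0 1.
have hX := bidegreeX; have hY := bidegreeY.
by case: i => -[|[|[|//]]] ?; split=> //=; apply: bidegreeD.
Qed.

Lemma bidegree_mirror n i P : pair_bidegree_le n P -> pair_bidegree_le (4 + n) (pmirror i P).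
Proof.
move=> [h1 h2]; have hd := bidegree_denom.
have H1 := bidegreeW (leq0n 2) bidegree1.
have HX := bidegree_X2; have HY := bidegree_Y2.
have HXX := bidegreeW (leqnSn 1) (bidegreeD bidegreeX bidegreeX).
have HYY := bidegreeW (leqnSn 1) (bidegreeD bidegreeY bidegreeY).
case: i => -[|[|[|//]]] ?; split; rewrite /pmirror /=.
1-4: rewrite -[4%N]/(2 + 2)%N -addnA; apply: bidegreeM; first exact: bidegreeD.
- by apply: bidegreeB; apply: bidegreeM => //; apply: bidegreeB.
- by apply: bidegreeB; apply: bidegreeM => //; apply: bidegreeB.
- by apply: bidegreeD; apply: bidegreeM => //; apply: bidegreeB.
- by apply: bidegreeD; apply: bidegreeM => //; apply: bidegreeB.
- exact: bidegreeM.
- by apply: bidegreeN; apply: bidegreeM.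
Qed.

Lemma bidegree_denomX k : bidegree_le (4 * k) (denom ^+ k).
Proof. exact: bidegreeXn bidegree_denom. Qed.

Lemma bidegree_subV k i P : pair_bidegree_le (4 * k + 1) P ->
  pair_bidegree_le (4 * k + 1) (P.1 - denom ^+ k * (pvertex i).1, P.2 - denom ^+ k * (pvertex i).2).
Proof.
move=> [h1 h2]; have [v1 v2] := bidegree_vertex i; have hd := bidegree_denomX k.
by split; apply: bidegreeB => //; apply: bidegreeM.
Qed.

Lemma bidegree_fold k i P : pair_bidegree_le (4 * k + 1) P ->
  pair_bidegree_le (4 * k.+1 + 1) (pfold i k P).
Proof.
move=> /(bidegree_subV (ordS i))/(bidegree_mirror i)[]; rewrite addnA -mulnS => h1 h2.
have [v1 v2] := bidegree_vertex (ordS i); have hd := bidegree_denomX k.+1.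
by split; apply: bidegreeD => //; apply: bidegreeM.
Qed.

Lemma bidegree_frame w j k P : pair_bidegree_le (4 * k + 1) P ->
  pair_bidegree_le (4 * (k + j) + 1) (pframe w j k P).
Proof.
elim: j k P => [|j IH] k P h; first by rewrite addn0.
by rewrite /= (addnS k) -(addSn k); apply: IH; apply: bidegree_fold.
Qed.

(** Each fold adds four to the degree and the vertex adds one, so each factor contributes at most
    [4 * m + 1]. *)
Lemma bidegree_cross w k l a b c m : (k <= m)%N -> (l <= m)%N ->
  bidegree_le (8 * m + 2) (pcross w k l a b c).
Proof.
move=> km lm.
have [b1 b2] := bidegree_subV a (@bidegree_frame w k 0 _ (bidegree_vertex b)).
have [c1 c2] := bidegree_subV a (@bidegree_frame w l 0 _ (bidegree_vertex c)).
have h : (4 * (0 + k) + 1 + (4 * (0 + l) + 1) <= 8 * m + 2)%N by lia.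
by apply: bidegreeW h _; apply: bidegreeB; apply: bidegreeM.
Qed.

Lemma eq_pframe w w' j k P : (forall l, (0 < l <= j)%N -> w l = w' l) ->
  pframe w j k P = pframe w' j k P.
Proof.
elim: j k P => //= j IH k P e; rewrite e ?leqnn// IH// => l /andP[l0 lj].
by rewrite e// l0 leqW.
Qed.

(** Only the letters 1 to [m] enter, so for each [m] there are finitely many such polynomials. *)
Lemma eq_pcross w w' k l a b c m : (k <= m)%N -> (l <= m)%N ->
  (forall j, (0 < j <= m)%N -> w j = w' j) -> pcross w k l a b c = pcross w' k l a b c.
Proof.
move=> km lm e; rewrite /pcross (@eq_pframe w w' k) 1?(@eq_pframe w w' l)//.
  by move=> j /andP[j0 jl]; rewrite e// j0 (leq_trans jl).
by move=> j /andP[j0 jk]; rewrite e// j0 (leq_trans jk).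
Qed.

Variables (R : realType) (a b : R).
Hypotheses (sa : 0 < sin a) (sb : 0 < sin b) (sab : 0 < sin (a + b)).

Definition cot (t : R) := cos t / sin t.
Local Notation x := (cot a).
Local Notation y := (cot b).
Local Notation q := ((1 + x ^+ 2) * (1 + y ^+ 2)).
Local Notation ev := (ev x y).
Local Notation evp P := (ev P.1, ev P.2).

Lemma cot_add_gt0 : 0 < x + y.
Proof.
rewrite (_ : x + y = sin (a + b) / (sin a * sin b)) ?divr_gt0 ?mulr_gt0//.
by rewrite sinD /cot; field; rewrite !gt_eqF.
Qed.

Lemma vertex_cot (i : 'I_3) : vertex a b i =
  match val i with 0 => (0, 0) | 1 => (1, 0) | _ => (x / (x + y), (x + y)^-1) end.
Proof.
case: i => -[|[|[|//]]] ? //=; rewrite /vertex /=.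
have e : cos a = x * sin a by rewrite /cot mulfVK// gt_eqF.
have xy := cot_add_gt0.
have s : sin (a + b) = (x + y) * (sin a * sin b).
  by rewrite sinD /cot; field; rewrite !gt_eqF.
rewrite s e; congr (_, _).
  by field; rewrite !gt_eqF.
by field; rewrite !gt_eqF.
Qed.

Lemma ev_denom : ev denom = q.
Proof. by rewrite /denom !(evM, evD, evXn, evX, evY, ev_one). Qed.

Lemma ev_vertex i : evp (pvertex i) = pscale (x + y) (vertex a b i).
Proof.
have xy := cot_add_gt0; rewrite vertex_cot /pvertex /pscale.
case: i => -[|[|[|//]]] ? /=; rewrite !(evM, evD, evXn, evX, evY, ev_one, ev0) ?mulr0 ?mulr1//.
by congr (_, _); field; rewrite gt_eqF.
Qed.

Lemma ev_mirror i P : evp (pmirror i P) = pscale q (mirror (edge (vertex a b) i) (evp P)).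
Proof.
have xy := cot_add_gt0.
have x0 : 1 + x ^+ 2 != 0 by rewrite gt_eqF// ltr_pwDl// sqr_ge0.
have y0 : 1 + y ^+ 2 != 0 by rewrite gt_eqF// ltr_pwDl// sqr_ge0.
have z0 : x + y != 0 by rewrite gt_eqF.
rewrite /edge !vertex_cot /pmirror /Defs.reflect /pscale /psub /dot.
case: i => -[|[|[|//]]] ? /=;
  rewrite /denom !(evM, evB, evN, evD, evXn, evX, evY, ev_one, ev0).
(* The squared side length is factored beforehand, so that [field] meets only denominators known to
   be nonzero. *)
- have d0 : (x / (x + y) - 1) * (x / (x + y) - 1) + ((x + y)^-1 - 0) * ((x + y)^-1 - 0)
     = (1 + y ^+ 2) / (x + y) ^+ 2 by field.
  by rewrite d0; congr (_, _); field; rewrite z0.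
- have d0 : (0 - x / (x + y)) * (0 - x / (x + y)) + (0 - (x + y)^-1) * (0 - (x + y)^-1)
     = (1 + x ^+ 2) / (x + y) ^+ 2 by field.
  by rewrite d0; congr (_, _); field; rewrite z0.
- have d0 : (1 - 0) * (1 - 0) + (0 - 0) * (0 - 0) = 1 :> R by ring.
  by rewrite d0; congr (_, _); field.
Qed.

Lemma ev_fold i k P p : evp P = pscale ((x + y) * q ^+ k) p ->
  evp (pfold i k P) = pscale ((x + y) * q ^+ k.+1) (fold_side (vertex a b) i p).
Proof.
move=> e; have Q := ev_mirror i (P.1 - denom ^+ k * (pvertex (ordS i)).1,
   P.2 - denom ^+ k * (pvertex (ordS i)).2).
have V := ev_vertex (ordS i).
have {}Q : evp (pmirror i (P.1 - denom ^+ k * (pvertex (ordS i)).1,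
   P.2 - denom ^+ k * (pvertex (ordS i)).2)) =
   pscale ((x + y) * q ^+ k.+1) (mirror (edge (vertex a b) i) (psub p (vertex a b (ordS i)))).
  rewrite Q /= !evB !evM evXn ev_denom.
  case: e => -> ->; case: V => -> ->.
  rewrite (_ : (_, _) = pscale ((x + y) * q ^+ k) (psub p (vertex a b (ordS i)))).
    rewrite reflect_pscale; set W := mirror _ _.
    by rewrite /pscale [in LHS]/= [in RHS]/= (exprS q); congr (_, _); ring.
  by rewrite /pscale /psub /=; congr (_, _); ring.
rewrite /pfold /fold_side /= !evD; case: Q => -> ->.
rewrite !evM !evXn ev_denom; case: V => -> ->.
by rewrite /pscale /padd /=; congr (_, _); ring.
Qed.

Lemma ev_frame w j k P p : evp P = pscale ((x + y) * q ^+ k) p ->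
  evp (pframe w j k P) = pscale ((x + y) * q ^+ (k + j)) (frame (vertex a b) w j p).
Proof.
elim: j k P p => [|j IH] k P p e; first by rewrite addn0.
by rewrite /= (addnS k) -(addSn k); apply: IH; apply: ev_fold.
Qed.

Lemma ev_cross w k l i1 i2 i3 : ev (pcross w k l i1 i2 i3) =
  (x + y) ^+ 2 * q ^+ (k + l) * vertex_cross (vertex a b) w k l i1 i2 i3.
Proof.
have V i : evp (pvertex i) = pscale ((x + y) * q ^+ 0) (vertex a b i).
  by rewrite expr0 mulr1 ev_vertex.
rewrite /pcross evB !evM !evB !evM !evXn ev_denom.
have [-> ->] := ev_frame w k (V i2); have [-> ->] := ev_frame w l (V i3).
have [-> ->] := ev_vertex i1.
rewrite !add0n exprD /vertex_cross /cross /psub /=; ring.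
Qed.

Lemma vertex_area i : cross (edge (vertex a b) i)
  (psub (vertex a b i) (vertex a b (ordS i))) = (x + y)^-1.
Proof.
have z0 : x + y != 0 by rewrite gt_eqF// cot_add_gt0.
rewrite /edge !vertex_cot; case: i => -[|[|[|//]]] ?; rewrite /cross /psub /=; by field.
Qed.

End PolynomialUnfolding.

(** * Sublevel sets and Borel-Cantelli *)

Section PolynomialSublevel.
Variable R : realType.

(** [s] lists the real parts of the complex roots: a real point is at least as far from a root as
    from its real part, and the complex factorisation gives the bound. *)
Lemma poly_ge_far_from_roots (p : {poly R}) : exists s : seq R, size s = (size p).-1 /\
  forall (x rho : R), 0 <= rho -> (forall z, z \in s -> rho <= `|x - z|) ->
    `|lead_coef p| * rho ^+ (size p).-1 <= `|p.[x]|.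
Proof.
pose iota : {rmorphism R -> complex R} := @real_complex R.
have [p0|pn0] := eqVneq p 0.
  by exists [::]; rewrite p0 size_poly0; split=> // x rho _ _; rewrite lead_coef0 normr0 mul0r.
have [r rE] := closed_field_poly_normal (map_poly iota p).
have lE : lead_coef (map_poly iota p) = iota (lead_coef p) by rewrite lead_coef_map.
have sr : size r = (size p).-1.
  rewrite -(size_map_poly iota p) rE size_scale ?size_prod_XsubC//.
  by rewrite lead_coef_eq0 map_poly_eq0.
exists [seq complex.Re z | z <- r]; split; first by rewrite size_map.
move=> x rho rho0 far.
have e : iota p.[x] = iota (lead_coef p) * \prod_(z <- r) (iota x - z).
  rewrite -horner_map rE hornerZ lE horner_prod; congr (_ * _).
  by apply: eq_bigr => z _; rewrite hornerXsubC.
have normE t : `|iota t| = iota `|t|.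
  by rewrite /iota normc_def /= expr0n addr0 sqrtr_sqr.
have le_iota s t : (iota s <= iota t) = (s <= t) by rewrite lecR.
rewrite -le_iota -normE e rmorphM normrM normE rmorphXn -sr.
rewrite ler_wpM2l -?normE ?normr_ge0//.
have {sr rE e} : forall z, z \in r -> iota rho <= `|iota x - z|.
  move=> z zr; apply: le_trans (normc_ge_Re _).
  by rewrite lecR /= raddfB /=; apply: far; apply: map_f.
elim: r {far} => [|z r IH] far; first by rewrite big_nil normr1.
rewrite big_cons exprS normrM ler_pM ?exprn_ge0 ?ler0c//.
  by apply: far; rewrite mem_head.
by apply: IH => u ur; apply: far; rewrite inE ur orbT.
Qed.

Lemma atan_contraction (u v : R) : `|atan u - atan v| <= `|u - v|.
Proof.
wlog uv : u v / v < u.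
  move=> h; have [vu|uv|->] := ltgtP v u; [exact: h| |by rewrite !subrr normr0].
  by rewrite distrC (distrC u); exact: h.
have [|c _ ->] := @MVT R atan (fun x => (1 + x ^+ 2)^-1) v u uv
    (fun x _ => is_derive1_atan x).
  by apply: continuous_subspaceT => x; exact: continuous_atan.
rewrite normrM ler_piMl//; have c2 : 1 <= 1 + c ^+ 2 by rewrite lerDl sqr_ge0.
by rewrite ger0_norm ?invr_ge0 ?(le_trans ler01)// invf_le1// (lt_le_trans ltr01).
Qed.

Lemma cotK (t : R) : 0 < t < pi -> pi / 2 - atan (cot t) = t.
Proof.
move=> /andP[t0 tpi].
have -> : cot t = tan (pi / 2 - t).
  by rewrite /cot /tan sinB cosB sin_pihalf cos_pihalf !mul1r !mul0r subr0 add0r.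
rewrite tanK ?opprB; last by rewrite in_itv /=; lra.
by lra.
Qed.

(** Angles are recovered from cotangents through the contraction [atan], so an interval of
    cotangents yields one of angles that is no wider. *)
Lemma cot_near (t z rho : R) : 0 < t < pi -> `|cot t - z| < rho ->
  ball (pi / 2 - atan z) rho t.
Proof.
move=> /cotK tE h; rewrite /ball /= -[t in (_ - t)]tE.
rewrite (_ : _ - _ = atan (cot t) - atan z); last by ring.
exact: le_lt_trans (atan_contraction _ _) h.
Qed.

Local Notation mu := (@lebesgue_measure R).

Lemma measure_near_roots (s : seq R) (E : set R) (rho : R) : 0 <= rho -> measurable E ->
  (forall t, E t -> 0 < t < pi /\ exists2 z, z \in s & `|cot t - z| < rho) ->
  (mu E <= ((size s)%:R * (2 * rho))%:E)%E.
Proof.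
move=> rho0 mE sub.
pose J i := ball (pi / 2 - atan (nth 0 s i)) rho.
have mJ i : measurable (J i) by exact: measurable_ball.
have h : E `<=` \big[setU/set0]_(i < size s) J i.
  move=> t /sub[t0 [z zs h]]; rewrite -bigcup_mkord; exists (index z s).
    by rewrite /= index_mem.
  by rewrite /J nth_index//; exact: cot_near.
have mJJ : measurable (\big[setU/set0]_(i < size s) J i).
  by apply: bigsetU_measurable => i _.
apply: (@le_trans _ _ (mu (\big[setU/set0]_(i < size s) J i))).
  by apply: le_measure; rewrite ?inE.
apply: (le_trans (Boole_inequality mu (fun i _ => mJ i))).
rewrite (eq_bigr (fun=> (rho *+ 2)%:E)); last first.
  by move=> i _; exact: lebesgue_measure_ball.
by rewrite sumEFin lee_fin big_const_ord iter_addr_0 -(mulr_natl (rho *+ 2)) -(mulr_natl rho).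
Qed.

End PolynomialSublevel.

(** * Sublevel sets in the space of pairs of angles *)

Section PlaneSublevel.
Variable R : realType.
Local Notation mu := (@lebesgue_measure R).
Local Notation mu2 := (mu \x mu)%E.
Implicit Types (F : {poly {poly int}}) (rho : R) (D : nat).

Lemma ev1E (x : R) (p : {poly int}) : ev1 x p = \sum_(i < size p) (p`_i)%:~R * x ^+ i.
Proof. by rewrite /ev1 /map_poly horner_poly. Qed.

Lemma evE (x y : R) F : ev x y F = \sum_(i < size F) ev1 x (F`_i) * y ^+ i.
Proof. by rewrite /ev /map_poly horner_poly. Qed.

Lemma measurable_cot : measurable_fun [set t : R | 0 < t < pi] (@cot R).
Proof.
have -> : [set t : R | 0 < t < pi] = `]0, pi[%classic by apply/seteqP; split=> t /=; rewrite in_itv.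
(* The inverse is written as a measurable power function; the two agree where the sine is
   positive. *)
apply: (eq_measurable_fun (fun t => cos t * (sin t `^ (-1)))).
  move=> t; rewrite inE /= in_itv /= => tpi.
  by rewrite powR_inv1 ?ltW// sin_gt0_pi.
apply: measurable_funS (@measurableT _ _) _ _ => //.
apply: measurable_funM.
  by apply: continuous_measurable_fun; exact: continuous_cos.
apply: (measurableT_comp (f := fun z : R => z `^ (-1))); first exact: measurable_powR.
by apply: continuous_measurable_fun; exact: continuous_sin.
Qed.

Lemma measurable_ev1 d (T : measurableType d) (A : set T) (f : T -> R) (p : {poly int}) :
  measurable_fun A f -> measurable_fun A (fun t => ev1 (f t) p).
Proof.
move=> mf; under eq_fun do rewrite ev1E.
apply: measurable_sum => i; apply: measurable_funM; first exact: measurable_cst.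
exact: measurable_funX.
Qed.

Lemma measurable_ev d (T : measurableType d) (A : set T) (f g : T -> R) F :
  measurable_fun A f -> measurable_fun A g -> measurable_fun A (fun t => ev (f t) (g t) F).
Proof.
move=> mf mg; under eq_fun do rewrite evE.
apply: measurable_sum => i; apply: measurable_funM; first exact: measurable_ev1.
exact: measurable_funX.
Qed.

Lemma measurable_norm_lt d (T : measurableType d) (A : set T) (f : T -> R) c :
  measurable A -> measurable_fun A f -> measurable (A `&` [set t | `|f t| < c]).
Proof.
move=> mA mf.
have mg : measurable_fun A (fun t => `|f t|) by apply: measurableT_comp => //; exact: normr_measurable.
rewrite (_ : [set _ | _] = (fun t => `|f t|) @^-1` `]-oo, c[%classic).
  by apply: mg => //; exact: measurable_itv.
by apply/seteqP; split=> t /=; rewrite in_itv.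
Qed.

Definition angles : set R := [set t | 0 < t < pi].

Lemma anglesE : angles = `]0, pi[%classic.
Proof. by apply/seteqP; split=> t /=; rewrite in_itv. Qed.

Lemma measurable_angles : measurable angles.
Proof. by rewrite anglesE; exact: measurable_itv. Qed.

Lemma measure_angles : (mu angles = pi%:E)%E.
Proof. by rewrite anglesE lebesgue_measure_itv /= lte_fin pi_gt0 sube0. Qed.

Definition sublevel F (c : R) : set (R * R) :=
  (angles `*` angles) `&` [set ab | `|ev (cot ab.1) (cot ab.2) F| < c].

Lemma measurable_sublevel F c : measurable (sublevel F c).
Proof.
have mA : measurable (angles `*` angles) by apply: measurableX; exact: measurable_angles.
apply: measurable_norm_lt => //; apply: measurable_ev.
  apply: (@measurable_comp _ _ _ _ _ _ angles); [exact: measurable_angles | | exact: measurable_cot |].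
    by move=> _ [[a b] [? ?] <-].
  by apply: measurable_funS (@measurableT _ _) _ _ => //; exact: measurable_fst.
apply: (@measurable_comp _ _ _ _ _ _ angles); [exact: measurable_angles | | exact: measurable_cot |].
  by move=> _ [[a b] [? ?] <-].
by apply: measurable_funS (@measurableT _ _) _ _ => //; exact: measurable_snd.
Qed.

(** A small value forces [cot t] within [rho] of the real part of a root. The degree may be less
    than [D]; then [rho <= 1] makes [rho ^+ D] the smaller power. *)
Lemma measure_poly_sublevel (p : {poly R}) D (c rho : R) (E : set R) : (size p <= D.+1)%N ->
  0 < rho <= 1 -> 0 < c <= `|lead_coef p| -> measurable E ->
  (forall t, E t -> angles t /\ `|p.[cot t]| < c * rho ^+ D) ->
  (mu E <= (D%:R * (2 * rho))%:E)%E.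
Proof.
move=> sp /andP[r0 r1] /andP[c0 cl] mE sub.
have [s [ss far]] := poly_ge_far_from_roots p.
apply: (@le_trans _ _ ((size s)%:R * (2 * rho))%:E); last first.
  by rewrite lee_fin ler_wpM2r ?mulr_ge0 ?(ltW r0)// ler_nat ss -subn1 leq_subLR add1n.
apply: measure_near_roots => //; first exact: ltW.
move=> t /sub[t0 h]; split=> //; apply: contrapT => H.
have := far (cot t) rho (ltW r0) _.
move=> /(_ _)/wrap[].
  by move=> z zs; rewrite leNgt; apply/negP => zt; apply: H; exists z.
apply/negP; rewrite -ltNge; apply: lt_le_trans h _.
apply: ler_pM; rewrite ?exprn_ge0 ?(ltW r0) ?(ltW c0)//.
by apply: ler_wiXn2l; rewrite ?(ltW r0)//; case: (size p) sp.
Qed.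

(** The one-variable bound is used twice: in [a], for the leading coefficient of [F] in y, whose own
    leading coefficient is a nonzero integer; then in [b], off the exceptional set [B], where the
    leading coefficient is at least [rho ^+ D]. Each use costs at most [2 * D * rho * pi], and
    [pi <= 4]. *)
Lemma measure_sublevel F D rho : F != 0 -> bidegree_le D F -> 0 < rho <= 1 ->
  (mu2 (sublevel F (rho ^+ D * rho ^+ D)) <= (16 * D%:R * rho)%:E)%E.
Proof.
move=> F0 [dF dFi] rho01; have [r0 r1] := andP rho01.
pose L := lead_coef F.
have L0 : L != 0 by rewrite lead_coef_eq0.
pose B := angles `&` [set a | `|ev1 (cot a) L| < 1 * rho ^+ D].
have mB : measurable B.
  apply: measurable_norm_lt; first exact: measurable_angles.
  by apply: measurable_ev1; exact: measurable_cot.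
have muB : (mu B <= (D%:R * (2 * rho))%:E)%E.
  apply: (@measure_poly_sublevel (map_poly intr L) _ 1) => //.
    by rewrite (leq_trans (size_poly _ _))// /L lead_coefE.
  rewrite ltr01 lead_coef_map_eq; last by rewrite intr_eq0 lead_coef_eq0.
  by rewrite -intr_norm ler1z -gtz0_ge1 normr_gt0 lead_coef_eq0.
pose S := sublevel F (rho ^+ D * rho ^+ D).
have mS : measurable S by exact: measurable_sublevel.
pose S' := S `&` (~` B `*` setT).
have mS' : measurable S' by apply: measurableI => //; apply: measurableX => //; exact: measurableC.
have mBA : measurable (B `*` angles) by apply: measurableX => //; exact: measurable_angles.
apply: (@le_trans _ _ (mu2 ((B `*` angles) `|` S'))).
  apply: le_measure; rewrite ?inE//; first exact: measurableU.
  move=> [a b] Sab; have [Ba|nBa] := pselect (B a); [left|right] => //.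
  by split=> //; case: Sab => -[].
apply: (@le_trans _ _ (mu2 (B `*` angles) + mu2 S')%E); first exact: measureU2.
have pi4 : (pi : R) <= 4 by have := @pihalf_lt2 R; lra.
have -> : (16 * D%:R * rho)%:E = ((D%:R * (2 * rho)) * 4)%:E + ((D%:R * (2 * rho)) * 4)%:E :> \bar R.
  by rewrite -EFinD; congr (_%:E); ring.
have c0 : 0 <= D%:R * (2 * rho) by rewrite !mulr_ge0// ltW.
apply: leeD.
  rewrite product_measure1E//; last exact: measurable_angles.
  apply: (@le_trans _ _ (mu B * pi%:E)%E); first by rewrite -measure_angles.
  by rewrite EFinM; apply: lee_pmul => //; rewrite lee_fin ?pi_ge0.
(* The product measure is the integral of the measures of the sections, which are bounded one by
   one. *)
apply: (@le_trans _ _ (\int[mu]_x ((D%:R * (2 * rho))%:E * (\1_angles x)%:E))%E).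
  apply: ge0_le_integral => //=.
  - exact: measurable_fun_xsection.
  - apply: measurable_funeM; apply/measurable_EFinP; apply: measurable_indic; exact: measurable_angles.
  move=> a _; have [[Aa nBa]|H] := pselect (angles a /\ ~ B a); last first.
    rewrite (_ : xsection S' a = set0) ?measure0 ?mule_ge0 ?lee_fin//.
    apply/seteqP; split=> // b; rewrite /xsection /= inE => -[[[Aa _] _] [nB _]].
    by case: H.
  rewrite indicE mem_set// mule1.
  have La : rho ^+ D <= `|ev1 (cot a) L|.
    by rewrite leNgt; apply/negP => h; apply: nBa; split=> //=; rewrite mul1r.
  have La0 : (horner_eval (cot a) \o map_poly intr) (lead_coef F) != 0.
    by rewrite -normr_gt0; apply: lt_le_trans La; rewrite exprn_gt0.
  apply: (@measure_poly_sublevel (map_poly (horner_eval (cot a) \o map_poly intr) F) _ (rho ^+ D)) => //.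
  - exact: leq_trans (size_poly _ _) dF.
  - by rewrite exprn_gt0//= lead_coef_map_eq.
  - exact: measurable_xsection.
  by move=> b; rewrite /xsection /= inE => -[[[_ Ab] h] _].
rewrite ge0_integralZl//.
- rewrite integral_indic// ?setIT; last exact: measurable_angles.
  apply: (@le_trans _ _ ((D%:R * (2 * rho))%:E * pi%:E)%E); first by rewrite -measure_angles.
  by rewrite -EFinM lee_fin ler_wpM2l.
- by apply/measurable_EFinP; apply: measurable_indic; exact: measurable_angles.
Qed.

End PlaneSublevel.

(** * The gap for almost every pair of angles *)

Section DiophantineGap.
Variable R : realType.
Local Notation mu := (@lebesgue_measure R).
Local Notation mu2 := (mu \x mu)%E.

Lemma measure_bigsetU_le d (T : measurableType d) (nu : {measure set T -> \bar R}) (I : eqType)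
    (s : seq I) (B : I -> set T) (c : R) : 0 <= c -> (forall i, measurable (B i)) ->
  (forall i, (nu (B i) <= c%:E)%E) ->
  (nu (\big[setU/set0]_(i <- s) B i) <= ((size s)%:R * c)%:E)%E.
Proof.
move=> c0 mB nB; elim: s => [|i s IH]; first by rewrite big_nil measure0 mul0r.
have mU : measurable (\big[setU/set0]_(j <- s) B j) by apply: bigsetU_measurable.
rewrite big_cons (le_trans (measureU2 _ _ _))//=.
by rewrite -natr1 mulrDl mul1r addrC EFinD leeD.
Qed.

(** The finite data on which a determinant over at most [m] steps depends. *)
Definition pattern (m : nat) : finType :=
  (m.+1.-tuple 'I_3 * ('I_m.+1 * 'I_m.+1) * ('I_3 * 'I_3 * 'I_3))%type.

Definition pattern_poly m (t : pattern m) : {poly {poly int}} :=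
  let: (u, (k, l), (a, b, c)) := t in pcross (nth ord0 u) k l a b c.

(** The base is twice 24, where [24 ^ m] bounds the number of patterns times their degree up to a
    constant; so the measures of the bad sets are summable. *)
Definition radius m : R := ((48 ^ m)%:R)^-1.
(** The threshold of [measure_sublevel] at the degree bound [8 * m + 2]. *)
Definition gap m : R := radius m ^+ (8 * m + 2) * radius m ^+ (8 * m + 2).

Lemma radius_bounds m : 0 < radius m <= 1.
Proof.
rewrite /radius invr_gt0 ltr0n expn_gt0 /=.
by rewrite invf_le1 ?ler1n ?ltr0n expn_gt0.
Qed.

(** Polynomials that vanish identically are left out: they come from triples collinear in every
    triangle. *)
Definition bad_angles m : set (R * R) :=
  \big[setU/set0]_(t <- enum (pattern m))
    (if pattern_poly t == 0 then set0 else sublevel (pattern_poly t) (gap m)).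

Lemma measurable_bad m : measurable (bad_angles m).
Proof.
apply: bigsetU_measurable => t _; case: ifP => // _; exact: measurable_sublevel.
Qed.

(** The words number [3 ^ m.+1]; the three factors linear in [m] are absorbed in [8 ^ m]. *)
Lemma pattern_count : exists c, forall m,
  (#|pattern m| * (16 * (8 * m + 2)) <= c * 24 ^ m)%N.
Proof.
pose c := (3 * 27 * 16 * 8)%N; exists c => m; rewrite {}/c.
rewrite /pattern !card_prod card_tuple !card_ord.
have h : (m.+1 <= 2 ^ m)%N by apply: ltn_expl.
have h3 : (m.+1 * (m.+1 * m.+1) <= 8 ^ m)%N.
  rewrite (_ : 8 = 2 * (2 * 2))%N// !expnMn.
  by apply: leq_mul => //; apply: leq_mul.
have h4 : (8 * m + 2 <= 8 * m.+1)%N by lia.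
rewrite (_ : 24 = 3 * 8)%N// expnMn expnS.
move: (3 ^ m)%N (8 ^ m)%N (8 * m + 2)%N h3 h4 => A B C h3 h4.
apply: (@leq_trans (3 * A * (m.+1 * m.+1) * (3 * 3 * 3) * (16 * (8 * m.+1)))).
  by rewrite !leq_mul.
rewrite (_ : (3 * 27)%N = (3 * (3 * 3 * 3))%N)//.
move: (3 * 3 * 3)%N 16%N => e f; move: 8%N => g.
rewrite (_ : (_ * _)%N = 3 * e * f * g * (A * (m.+1 * (m.+1 * m.+1))))%N; last first.
  by move: m.+1 3%N => n d; ring.
by rewrite !leq_mul.
Qed.

Lemma measure_bad : exists c : R, 0 <= c /\
  forall m, (mu2 (bad_angles m) <= (c / (2 ^ m.+1)%:R)%:E)%E.
Proof.
have [N0 hN0] := pattern_count; exists (2 * N0%:R); split=> [|m]; first by rewrite mulr_ge0.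
have /andP[r0 r1] := radius_bounds m.
pose c : R := 16 * (8 * m + 2)%:R * radius m.
have c0 : 0 <= c by rewrite /c !mulr_ge0// ltW.
apply: (@le_trans _ _ ((size (enum (pattern m)))%:R * c)%:E).
  apply: measure_bigsetU_le => // t.
    by case: ifP => // _; exact: measurable_sublevel.
  case: ifPn => [_|n0]; first by rewrite measure0 lee_fin.
  apply: measure_sublevel => //; last exact: radius_bounds.
  by case: t n0 => -[u [k l]] [[i j] h] _; apply: bidegree_cross; rewrite -ltnS.
rewrite lee_fin -cardE /c -natrM mulrA -natrM /radius.
have := hN0 m; rewrite -(ler_nat R).
move: (#|pattern m| * _)%N => N h.
rewrite ler_pdivrMr ?ltr0n ?expn_gt0//; apply: le_trans h _.
rewrite (_ : (48 = 24 * 2)%N)// expnMn expnS !natrM.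
have : (2 ^ m)%:R != 0 :> R by rewrite pnatr_eq0 expn_eq0.
move: (2 ^ m)%:R (24 ^ m)%:R => x y x0.
by rewrite le_eqVlt; apply/orP; left; apply/eqP; field.
Qed.

(** Borel-Cantelli, with the measures bounded by a geometric series. *)
Lemma bad_negligible : mu2 (lim_sup_set bad_angles) = 0%E.
Proof.
have [c [c0 hc]] := measure_bad.
apply: lim_sup_set_cvg0; first exact: measurable_bad.
apply: (@le_lt_trans _ _ (c%:E : \bar R)); last exact: ltry.
apply: le_trans (@epsilon_trick0 R c xpredT c0).
by apply: lee_nneseries => // m _; exact: hc.
Qed.

Lemma eventually_gap (ab : R * R) : angles ab.1 -> angles ab.2 ->
  ~ lim_sup_set bad_angles ab -> exists m0, forall m, (m0 <= m)%N ->
  forall w k l a b c, (k <= m)%N -> (l <= m)%N ->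
    pcross w k l a b c = 0 \/
    gap m <= `|ev (cot ab.1) (cot ab.2) (pcross w k l a b c)|.
Proof.
move=> A1 A2 nB; apply: contrapT => H; apply: nB => n _; apply: contrapT => H2; apply: H.
exists n => m nm w k l a b c km lm.
(* Truncation to the letters 0 to [m] makes the infinite word one of the finitely many patterns. *)
pose u := [tuple w (val j) | j < m.+1].
have uE : pcross w k l a b c = pcross (nth ord0 u) k l a b c.
  apply: (@eq_pcross _ _ _ _ _ _ _ m) => // j /andP[_ jm].
  by rewrite (_ : j = val (Ordinal (jm : (j < m.+1)%N)))// nth_mktuple.
pose t : pattern m := (u, (Ordinal (km : (k < m.+1)%N), Ordinal (lm : (l < m.+1)%N)), (a, b, c)).
have tE : pattern_poly t = pcross w k l a b c by rewrite uE.
have [->|n0] := eqVneq (pcross w k l a b c) 0; [by left|right].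
rewrite leNgt; apply/negP => h; apply: H2; exists m => //.
rewrite /bad_angles -bigcup_seq; exists t; first by rewrite /= mem_enum.
by rewrite tE (negPf n0).
Qed.

End DiophantineGap.

(** * Counting *)

Section CountingPeriodicTypes.
Variables (R : realType) (v : 'I_3 -> point R) (A M : R) (K : nat).
Hypotheses (A_gt0 : 0 < A) (M_gt0 : 0 < M).
Hypothesis area : forall i, cross (edge v i) (psub (v i) (v (ordS i))) = A.
Hypothesis vM : forall k, `|(v k).1| <= M /\ `|(v k).2| <= M.
Hypothesis K_travel : forall w P d len, trajectory v w P -> straight v w P d len ->
  forall j, 3 * (3 * M) <= tau v w P d (j + K.+1) - tau v w P d j.
Local Notation D := (3 * M).

(** Consecutive sides differ, so a turn selects one of the two remaining sides. *)
Lemma letters_of_turns (w w' : nat -> 'I_3) n : (forall j, w j != w j.+1) ->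
  (forall j, w' j != w' j.+1) -> w 0%N = w' 0%N ->
  (forall j, (j < n)%N -> turn w j = turn w' j) -> forall j, (j <= n)%N -> w j = w' j.
Proof.
move=> ww ww' e0 te; elim=> // j IH jn; have e := IH (ltnW jn).
have := te j jn; rewrite /turn e => /addIb.
have := ww j; have := ww' j; rewrite e.
have [->|->|->] := ord3P (w' j) (w j.+1); have [->|->|->] := ord3P (w' j) (w' j.+1);
  rewrite ?eqxx// => _ _.
  by move=> /esym/eqP ->.
by move=> /eqP ->.
Qed.

(** Every index is at most [2 * B / e], so [inord] loses nothing, and equal indices put both numbers
    in one interval of length [e]. *)
Lemma grid_near (e x y B : R) (L : nat) : 0 < e -> `|x| <= B -> `|y| <= B -> 2 * B / e < L.+1%:R ->
  inord (Num.truncn ((x + B) / e)) = inord (Num.truncn ((y + B) / e)) :> 'I_L.+1 ->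
  `|x - y| <= e.
Proof.
rewrite !ler_norml => e0 /andP[x1 x2] /andP[y1 y2] hL h.
have pos z : - B <= z -> 0 <= (z + B) / e by move=> ?; rewrite divr_ge0 ?(ltW e0)//; lra.
have lt z : - B <= z -> z <= B -> (Num.truncn ((z + B) / e) < L.+1)%N.
  move=> z1 z2; rewrite truncn_lt_nat ?pos//; apply: le_lt_trans hL.
  by rewrite ler_pM2r ?invr_gt0//; lra.
have {}h : Num.truncn ((x + B) / e) = Num.truncn ((y + B) / e).
  by have := congr1 val h; rewrite /= !inordK ?lt.
have := truncn_itv (pos x x1); have := truncn_itv (pos y y1); rewrite h => /andP[a1 a2] /andP[b1 b2].
rewrite -natr1 in a2 b2.
have : `|(x + B) / e - (y + B) / e| <= 1 by rewrite ler_norml; apply/andP; split; lra.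
rewrite -mulrBl (_ : x + B - (y + B) = x - y); last by ring.
by rewrite normrM (gtr0_norm (_ : 0 < e^-1)) ?invr_gt0// ler_pdivrMr// mul1r -ler_norml.
Qed.

Variables (k N m L : nat) (del : R).
Hypotheses (kN : (k <= N)%N) (m_gt0 : (0 < m)%N) (del_gt0 : 0 < del).
(** Chosen so that the smallness condition of [no_split_beyond_crossing] reads [del / 2 < del]. *)
Let e := del / (16 * (N.+1%:R * D) * (N%:R * D + 1)).
Hypothesis gap : forall w i l a b c, (i <= l)%N -> (l <= m)%N ->
  vertex_cross v w i l a b c = 0 \/ del <= `|vertex_cross v w i l a b c|.
Hypothesis L_big : 2 * (M + 1) / e < L.+1%:R.

Let e_gt0 : 0 < e.
Proof. by rewrite divr_gt0// !mulr_gt0 ?ltr0Sn// ltr_wpDl// mulr_ge0// mulr_ge0// ltW. Qed.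

(** A box fixes the first letter and, up to [e], the start and the direction: these are
    [3 * L.+1 ^ 4] choices. The remaining factor counts the times recorded by [itinerary_code], two
    for each cell. *)
Lemma card_ray_codes (S : {set k.-tuple 'I_3}) :
  (forall w, w \in S -> exists r : (nat -> point R) * point R, billiard_ray v (code w) r.1 r.2) ->
  (#|S| <= 3 * L.+1 ^ 4 * k.+1 ^ ((N %/ m).+1 * K.+1 * 2))%N.
Proof.
move=> Srays.
have /boolp.choice[f fP] w : exists r : (nat -> point R) * point R,
    w \in S -> billiard_ray v (code w) r.1 r.2.
  have [/Srays[r hr]|_] := boolP (w \in S); first by exists r.
  by exists (fun=> (0, 0), (0, 0)).
pose grid (x : R) : 'I_L.+1 := inord (Num.truncn ((x + (M + 1)) / e)).
pose P0 w := (f w).1 0%N.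
pose box w := (code w 0, ((grid (P0 w).1, grid (P0 w).2), (grid (f w).2.1, grid (f w).2.2))).
(* A block of length [m] and a residue modulo [K.+1]: distinct times in a cell are at most [m]
   apart, as the gap requires, and at least [K.+1] apart, so that the apexes advance. *)
pose cell j : 'I_(N %/ m).+1 * 'I_K.+1 := (inord (j %/ m), inord (j %% K.+1)).
have sep : {in S &, forall w w', box w = box w' ->
    (forall j, (j < k)%N -> turn (code w) j = turn (code w') j) -> w = w'}.
  move=> w w' wS w'S boxE turnE.
  have [wP _] := fP w wS; have [w'P _] := fP w' w'S.
  have [_ ww _] := wP; have [_ ww' _] := w'P.
  have w0 : code w 0 = code w' 0 by case: boxE.
  apply: eq_from_tnth => i; rewrite !(tnth_nth ord0).
  have := letters_of_turns ww ww' w0 turnE (ltnW (ltn_ord i)).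
  by rewrite /Defs.code modn_small.
have near w w' : w \in S -> w' \in S -> box w = box w' ->
    near_rays e (code w, (f w).1, (f w).2) (code w', (f w').1, (f w').2).
  move=> wS w'S [_ g1 g2 g3 g4]; have rw := fP w wS; have rw' := fP w' w'S.
  have c z : z \in S -> [/\ `|(P0 z).1| <= M + 1, `|(P0 z).2| <= M + 1,
      `|(f z).2.1| <= M + 1 & `|(f z).2.2| <= M + 1].
    move=> /fP[[ons _ _] [len line]].
    have [p1 p2] := in_side_bounded vM (ons 0%N).
    have [|q1 q2] := coord_le_dot (z := (f z).2) (ler01 : 0 <= 1 :> R).
      by rewrite line.1 expr1n.
    have M1 : M <= M + 1 by rewrite lerDl.
    have M2 : 1 <= M + 1 by rewrite lerDr ltW.
    by split; [exact: le_trans p1 M1|exact: le_trans p2 M1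
              |exact: le_trans q1 M2|exact: le_trans q2 M2].
  have [a1 a2 a3 a4] := c w wS; have [b1 b2 b3 b4] := c w' w'S.
  by split; apply: (grid_near e_gt0 _ _ L_big).
have spl w j : (j <= k)%N -> w \in S -> split_at S box k (fun w j => turn (code w) j) w j ->
  exists w1 w2, [/\ w1 \in S, w2 \in S, box w1 = box w /\ box w2 = box w,
    (forall l, (l <= j)%N -> code w l = code w1 l) /\ (forall l, (l <= j)%N -> code w l = code w2 l)
    & turn (code w1) j != turn (code w2) j].
  move=> jk wS /exists_inP[w1 w1S /exists_inP[w2 w2S /and3P[]]].
  move=> /(agreeP _ _ _ _ jk)[e1 t1] /(agreeP _ _ _ _ jk)[e2 t2] ne.
  have [[_ ww _] _] := fP w wS; have [[_ ww1 _] _] := fP w1 w1S; have [[_ ww2 _] _] := fP w2 w2S.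
  exists w1, w2; split=> //; split.
    by apply: letters_of_turns t1 => //; case: e1.
  by apply: letters_of_turns t2 => //; case: e2.
have cellE i j : (i < j)%N -> (j < k)%N -> cell i = cell j -> (i + K.+1 <= j)%N /\ (j - i <= m)%N.
  move=> ij jk [/(congr1 val) c1 /(congr1 val) c2].
  have b l : (l < k)%N -> (l %/ m < (N %/ m).+1)%N.
    by move=> lk; rewrite ltnS leq_div2r// (leq_trans (ltnW lk)).
  rewrite /= !inordK ?b ?ltn_mod ?(ltn_trans ij)// in c1 c2.
  split.
    have /dvdnP[q qE] : (K.+1 %| j - i)%N by rewrite -eqn_mod_dvd ?(ltnW ij)// c2.
    have q0 : (0 < q)%N by case: q qE => // qE; move: ij; rewrite -subn_gt0 qE.
    rewrite -leq_subRL ?(ltnW ij)// qE.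
    by rewrite leq_pmull.
  rewrite leq_subLR (divn_eq i m) (divn_eq j m) c1 -addnA leq_add2l.
  by rewrite (leq_trans (ltnW (ltn_pmod _ m_gt0)))// leq_addl.
have main w j1 j2 j3 : w \in S -> (j1 < j2)%N -> (j2 < j3)%N -> (j3 < k)%N ->
    cell j1 = cell j3 -> cell j2 = cell j3 ->
    split_at S box k (fun w j => turn (code w) j) w j1 ->
    split_at S box k (fun w j => turn (code w) j) w j2 ->
    split_at S box k (fun w j => turn (code w) j) w j3 ->
    turn (code w) j1 = turn (code w) j2.
  move=> wS j12 j23 j3k c13 c23.
  have j2k := ltn_trans j23 j3k; have j1k := ltn_trans j12 j2k.
  have [k12 _] := cellE _ _ j12 j2k (etrans c13 (esym c23)).
  have [k23 _] := cellE _ _ j23 j3k c23.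
  have [_ jm] := cellE _ _ (ltn_trans j12 j23) j3k c13.
  move=> /(spl _ _ (ltnW j1k) wS)[u1 [u1' [u1S u1'S [b1 b1'] [a1 a1'] t1]]].
  move=> /(spl _ _ (ltnW j2k) wS)[u2 [u2' [u2S u2'S [b2 b2'] [a2 a2'] t2]]].
  move=> /(spl _ _ (ltnW j3k) wS)[u3 [u3' [u3S u3'S [b3 b3'] [a3 a3'] t3]]].
  (* Of the two witnesses at [j3], one turns differently from [w]; it serves as the second ray. *)
  have [u [uS bu au tu]] : exists u, [/\ u \in S, box u = box w,
      forall l, (l <= j3)%N -> code w l = code u l & turn (code w) j3 != turn (code u) j3].
    have [tE|tE] := eqVneq (turn (code w) j3) (turn (code u3) j3).
      by exists u3'; split=> //; rewrite tE.
    by exists u3.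
  have small : 8 * (N.+1%:R * D) * (e * (N%:R * D + 1)) < del.
    rewrite (_ : _ * _ = del / 2); first by rewrite ltr_pdivrMr// ltr_pMr// ltr1n.
    rewrite /e; field; rewrite !gt_eqF// ?ltr0Sn//.
    by rewrite ltr_wpDl// mulr_ge0// mulr_ge0// ltW.
  have turnE j : (j < j3)%N -> turn (code u) j = turn (code w) j.
    by move=> jj; rewrite /turn !au// ltnW.
  exact: (no_split_beyond_crossing A_gt0 area M_gt0 vM K_travel (ltW e_gt0) gap small k12 k23
    jm (leq_trans j3k kN) (fP w wS) (fP u uS) (fP u1 u1S) (fP u1' u1'S) (fP u2 u2S) (fP u2' u2'S)
    (near _ _ uS wS bu) (near _ _ wS wS erefl) (near _ _ u1S wS b1) (near _ _ u1'S wS b1')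
    (near _ _ u2S wS b2) (near _ _ u2'S wS b2') au a1 a1' a2 a2' t1 t2 tu
    (turnE _ (ltn_trans j12 j23)) (turnE _ j23)).
apply: (@leq_trans (#|{: 'I_3 * ('I_L.+1 * 'I_L.+1 * ('I_L.+1 * 'I_L.+1))}|
    * k.+1 ^ (#|{: 'I_(N %/ m).+1 * 'I_K.+1}| * 2))); last first.
  by rewrite !card_prod !card_ord leq_mul// !expnS expn0 muln1 !mulnA.
apply: (card_itineraries (cell := cell) sep).
move=> w wS j1 j2 j3 j13 j23 j3k c1 c2 s1 s2 s3.
have [j12|j21|->//] := ltngtP j1 j2.
  exact: (main w j1 j2 j3).
by apply/esym; apply: (main w j2 j1 j3).
Qed.

End CountingPeriodicTypes.

(** * Choice of the block length and the final exponent *)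

Section Growth.
Variable R : realType.

(** The larger of [c] and [y] absorbs the product. A constant factor is thus traded for one more
    power. *)
Lemma pow_le_next (c y : R) n : 0 <= c -> 0 <= y -> c * y ^+ n <= y ^+ n.+1 + c ^+ n.+1.
Proof.
move=> c0 y0; have [cy|yc] := leP c y.
  by rewrite exprS (le_trans (y := y * y ^+ n)) ?ler_wpM2r ?exprn_ge0// lerDl exprn_ge0.
rewrite [c ^+ n.+1]exprS (le_trans (y := c * c ^+ n)) ?lerDr ?exprn_ge0//.
by rewrite ler_wpM2l// lerXn2r ?nnegrE ?(ltW yc).
Qed.

Lemma le_expR (x : R) : x <= expR x.
Proof. by apply: le_trans (expR_ge1Dx x); rewrite lerDr. Qed.

(** The exponent [42 / 60] exceeds [2 / 3], which leaves room for the logarithm. *)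
Lemma seven_tenths : (42%:R / 60%:R : R) <= Num.sqrt 3 - 1.
Proof.
have h : (17 / 10 : R) <= Num.sqrt 3.
  have s0 : 0 <= Num.sqrt (3 : R) by exact: sqrtr_ge0.
  have s2 : Num.sqrt (3 : R) ^+ 2 = 3 by rewrite sqr_sqrtr.
  by nra.
by lra.
Qed.

(** With [y = N ^ (1/60)], the block length [m] is of order [y ^ 20], [N %/ m] is at most [y ^ 40]
    and [log N.+1] at most [61 * y]. The total exponent is at most [c * y ^ 41], hence at most
    [y ^ 42 + c ^ 42]. *)
Lemma growth_bound (Q G eps : R) (m1 k : nat) : 0 <= Q -> 1 <= G -> 0 < eps ->
  exists C : R, 0 < C /\ forall N : nat, (1 <= N)%N -> exists m, [/\ (m1 <= m)%N, (0 < m)%N &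
    Q * N.+1%:R ^+ (9 + k * (N %/ m).+1) * (G ^+ (m * m)) ^+ 4 <
    C * expR (N%:R `^ (Num.sqrt 3 - 1 + eps))].
Proof.
move=> Q0 G1 eps0.
pose c : R := 61 * (9 + k%:R * 2) + 4 * G * (2 + m1%:R) ^+ 2.
have G0 : 0 <= G by lra.
have c0 : 0 <= c by rewrite /c addr_ge0// !mulr_ge0// ?addr_ge0// ?sqr_ge0// ?mulr_ge0.
(* The summand 1 makes the final inequality strict. *)
exists (Q * expR (c ^+ 42) + 1); split; first by rewrite ltr_wpDl// mulr_ge0// expR_ge0.
move=> N N1; pose y : R := N%:R `^ (60%:R^-1).
have N1R : 1 <= N%:R :> R by rewrite ler1n.
have y1 : 1 <= y by rewrite -(powRr0 N%:R) ler_powR// invr_ge0.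
have y0 : 0 <= y by lra.
have yN : y ^+ 60 = N%:R by rewrite -powR_mulrn// -powRrM mulVf ?powRr1.
have y42 : y ^+ 42 <= N%:R `^ (Num.sqrt 3 - 1 + eps).
  rewrite -powR_mulrn// -powRrM ler_powR// mulrC.
  by have := seven_tenths; lra.
(* The successor ensures [m >= y ^ 20], and adding [m1] ensures [m >= m1]. *)
pose t := Num.truncn (y ^+ 20); pose m := (t.+1 + m1)%N.
exists m; split; [exact: leq_addl|by []|].
have /andP[t1 t2] := truncn_itv (exprn_ge0 20 y0); rewrite -/t in t1 t2.
have y20 : 1 <= y ^+ 20 by rewrite exprn_ege1.
have mle : m%:R <= (2 + m1%:R) * y ^+ 20.
  rewrite /m natrD -natr1 mulrDl.
  have : m1%:R * 1 <= m1%:R * y ^+ 20 by rewrite ler_wpM2l.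
  lra.
have ym : y ^+ 20 <= m%:R by rewrite /m natrD (le_trans (ltW t2))// lerDl.
have Nm : (N %/ m)%:R <= y ^+ 40.
  have m0 : 0 < m%:R :> R by lra.
  rewrite -(ler_pM2r m0) -natrM (le_trans (y := N%:R)) ?ler_nat ?leq_divM//.
  by rewrite -yN (exprD _ 40 20) ler_wpM2l// exprn_ge0.
(* Here [N.+1 <= 2 * N <= expR 1 * y ^ 60], and both [expR 1] and [y] are at most [expR y]. *)
have N1e : N.+1%:R <= expR (61 * y).
  apply: (@le_trans _ _ (expR 1 * y ^+ 60)).
    have := @expR_ge1Dx R 1; rewrite -natr1 yN => h.
    by rewrite (le_trans (y := 2 * N%:R)) ?ler_wpM2r//; lra.
  rewrite (_ : 61 * y = y + y * 60%:R); last by ring.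
  rewrite expRD ler_pM ?expR_ge0 ?exprn_ge0 ?ler_expR//.
  by rewrite expRM_natr lerXn2r ?nnegrE ?expR_ge0 ?le_expR.
have y4041 : y ^+ 40 <= y ^+ 41 by rewrite (exprS y 40) ler_peMl ?exprn_ge0.
have y40 : 1 <= y ^+ 40 by rewrite exprn_ege1.
have b1 : N.+1%:R ^+ (9 + k * (N %/ m).+1) <= expR (61 * (9 + k%:R * 2) * y ^+ 41).
  apply: (@le_trans _ _ (expR (61 * y) ^+ (9 + k * (N %/ m).+1))).
    by rewrite lerXn2r ?nnegrE ?expR_ge0.
  rewrite -expRM_natr ler_expR natrD natrM -[(N %/ m).+1%:R]natr1.
  rewrite (_ : 61 * (9 + k%:R * 2) * y ^+ 41 = 61 * y * ((9 + k%:R * 2) * y ^+ 40)); last first.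
    by rewrite (exprS y 40); ring.
  rewrite ler_wpM2l ?mulr_ge0// mulrDl lerD ?ler_peMr//.
  by rewrite -mulrA ler_wpM2l//; lra.
have b2 : (G ^+ (m * m)) ^+ 4 <= expR (4 * G * (2 + m1%:R) ^+ 2 * y ^+ 41).
  rewrite -exprM; apply: (@le_trans _ _ (expR G ^+ (m * m * 4))).
    by rewrite lerXn2r ?nnegrE ?expR_ge0 ?le_expR.
  rewrite -expRM_natr ler_expR !natrM.
  have mm : m%:R * m%:R <= (2 + m1%:R) ^+ 2 * y ^+ 41.
    apply: (@le_trans _ _ (((2 + m1%:R) * y ^+ 20) * ((2 + m1%:R) * y ^+ 20))).
      by rewrite ler_pM.
    rewrite (_ : _ * _ = (2 + m1%:R) ^+ 2 * y ^+ 40); last by rewrite (exprD y 20 20); ring.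
    by rewrite ler_wpM2l// sqr_ge0.
  rewrite (_ : 4 * G * _ * _ = G * ((2 + m1%:R) ^+ 2 * y ^+ 41 * 4)); last by ring.
  by rewrite ler_wpM2l// ler_wpM2r.
apply: (@le_lt_trans _ _ (Q * expR (c * y ^+ 41))).
  by rewrite -mulrA ler_wpM2l// /c mulrDl expRD ler_pM// ?exprn_ge0.
apply: (@le_lt_trans _ _ (Q * (expR (c ^+ 42) * expR (N%:R `^ (Num.sqrt 3 - 1 + eps))))).
  rewrite ler_wpM2l// -expRD ler_expR (le_trans (pow_le_next 41 c0 y0))//.
  by rewrite addrC lerD2l.
by rewrite mulrA ltr_pM2r ?expR_gt0// ltrDl.
Qed.

End Growth.

Lemma gap_pow (R : realType) m : gap R m = (48%:R ^+ (m * (8 * m + 2) * 2))^-1.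
Proof.
rewrite /gap /radius natrX; move: (48%:R : R) => r.
by rewrite !exprVn -invfM -!exprM -exprD muln2 -addnn.
Qed.

(** * The bound for one triangle satisfying the gap *)

Section TypicalTriangle.
Variables (R : realType) (a b : R).
Hypotheses (a_gt0 : 0 < a) (b_gt0 : 0 < b) (ab_lt_pi : a + b < pi).
Local Notation v := (vertex a b).

Let sa : 0 < sin a.
Proof. by apply: sin_gt0_pi; rewrite a_gt0 (lt_trans _ ab_lt_pi)// ltrDl. Qed.

Let sb : 0 < sin b.
Proof. by apply: sin_gt0_pi; rewrite b_gt0 (lt_trans _ ab_lt_pi)// ltrDr. Qed.

Let sab : 0 < sin (a + b).
Proof. by apply: sin_gt0_pi; rewrite ab_lt_pi addr_gt0. Qed.

Lemma periodic_ray k (w : k.-tuple 'I_3) : periodic_type a b w ->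
  exists r : (nat -> point R) * point R, billiard_ray v (code w) r.1 r.2.
Proof.
move=> [p [_ [ons [ww law]]]].
have wp : trajectory v (code w) p by split.
have A0 : 0 < (cot a + cot b)^-1 by rewrite invr_gt0 cot_add_gt0.
have [d [len line]] := unfolded_straight A0 (vertex_area sa sb sab) wp.
by exists (p, d); split=> //; exists len.
Qed.

(** [ev_cross] turns the lower bound for polynomials into one for determinants, at the cost of [Z]
    and at most [2 * m] factors [q]. *)
Lemma vertex_gap (m0 : nat) :
  (forall m, (m0 <= m)%N -> forall w k l i1 i2 i3, (k <= m)%N -> (l <= m)%N ->
    pcross w k l i1 i2 i3 = 0 \/
    gap R m <= `|ev (cot a) (cot b) (pcross w k l i1 i2 i3)|) ->
  exists2 G : R, 1 <= G & forall m, (m0 <= m)%N -> (0 < m)%N ->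
    forall w k l i1 i2 i3, (k <= l)%N -> (l <= m)%N ->
    vertex_cross v w k l i1 i2 i3 = 0 \/
    (G ^+ (m * m))^-1 <= `|vertex_cross v w k l i1 i2 i3|.
Proof.
move=> gap_ev; have xy := cot_add_gt0 sa sb sab.
pose Z := (cot a + cot b) ^+ 2.
pose q := (1 + cot a ^+ 2) * (1 + cot b ^+ 2).
have Z0 : 0 < Z by rewrite exprn_gt0.
have q1 : 1 <= q by rewrite mulr_ege1// lerDl sqr_ge0.
have := @ler1n R 48; set r : R := 48%:R => /= r1.
have le2 (z : R) n n' : 1 <= z -> (n <= n')%N -> z ^+ n <= z ^+ n' by move=> *; apply: ler_weXn2l.
have [q0 r0] : 0 < q /\ 0 < r by split; lra.
(* The exponents come from [2 * m <= 2 * m ^ 2] and [16 * m ^ 2 + 4 * m <= 20 * m ^ 2]; [1 + Z]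
   replaces [Z] so that its powers dominate [Z]. *)
have G1 : 1 <= (1 + Z) * q ^+ 2 * r ^+ 20.
  by apply: mulr_ege1; [apply: mulr_ege1|]; rewrite ?exprn_ege1// lerDl ltW.
exists ((1 + Z) * q ^+ 2 * r ^+ 20) => // m mm0 m_gt0 w k l i1 i2 i3 kl lm.
have E := ev_cross sa sb sab w k l i1 i2 i3; rewrite -/Z -/q in E.
have q0' : 0 < q ^+ (k + l) by rewrite exprn_gt0.
have [e0|] := gap_ev m mm0 w k l i1 i2 i3 (leq_trans kl lm) lm.
  left; move: E; rewrite e0 ev0 => /esym/eqP.
  by rewrite mulf_eq0 (gt_eqF (mulr_gt0 Z0 q0')) => /eqP.
rewrite E (normrM (Z * _)) (gtr0_norm (mulr_gt0 Z0 q0')) => h; right.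
rewrite gap_pow -/r in h.
set X := `|vertex_cross _ _ _ _ _ _ _| in h *.
have X0 : 0 <= X by exact: normr_ge0.
have H1 : (r ^+ (m * (8 * m + 2) * 2))^-1 <= Z * q ^+ (2 * m) * X.
  apply: le_trans h _; rewrite ler_wpM2r ?normr_ge0// ler_wpM2l ?(ltW Z0)//.
  by apply: le2 => //; rewrite mul2n -addnn leq_add// (leq_trans kl).
rewrite -[_^-1]mul1r ler_pdivrMr ?exprn_gt0 ?(lt_le_trans ltr01)//.
rewrite -[_^-1]mul1r ler_pdivrMr ?exprn_gt0// in H1.
apply: (le_trans H1); clear -q1 q0 Z0 r1 r0 le2 m_gt0 X0; clearbody X r q Z.
rewrite mulrAC mulrC ler_wpM2l ?X0//.
rewrite (exprMn (m * m) ((1 + Z) * q ^+ 2)) (exprMn (m * m) (1 + Z)) -(exprM q) -(exprM r).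
apply: ler_pM; [by rewrite mulr_ge0 ?exprn_ge0 ?ltW|by rewrite exprn_ge0 ?ltW| |].
  apply: ler_pM; [exact: ltW|by rewrite exprn_ge0 ?ltW| |].
    have mm : (0 < m * m)%N by rewrite muln_gt0 m_gt0.
    rewrite -(prednK mm) exprS; apply: (@le_trans _ _ ((1 + Z) * 1)); first by rewrite mulr1 lerDr.
    by rewrite ler_wpM2l ?exprn_ege1 ?addr_ge0 ?lerDl ?ltW.
  by apply: le2 => //; nia.
by apply: le2 => //; nia.
Qed.

(** [card_ray_codes] is applied to each length up to [N], with [L] of order [N ^ 2 * G ^ (m * m)]:
    its fourth power gives [N ^ 8], and the sum over the lengths gives the ninth factor. *)
Lemma Per_bound (m0 : nat) :
  (forall m, (m0 <= m)%N -> forall w k l i1 i2 i3, (k <= m)%N -> (l <= m)%N ->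
    pcross w k l i1 i2 i3 = 0 \/
    gap R m <= `|ev (cot a) (cot b) (pcross w k l i1 i2 i3)|) ->
  exists Q G : R, exists c : nat, [/\ 0 <= Q, 1 <= G &
    forall m N, (m0 <= m)%N -> (0 < m)%N ->
    (Per a b N)%:R <= Q * N.+1%:R ^+ (9 + c * (N %/ m).+1) * (G ^+ (m * m)) ^+ 4].
Proof.
move=> /vertex_gap[G G1 gapG].
have A0 : 0 < (cot a + cot b)^-1 by rewrite invr_gt0 cot_add_gt0.
have area := vertex_area sa sb sab.
pose M : R := 1 + \sum_i (`|(v i).1| + `|(v i).2|).
have [M1 vM] : 1 <= M /\ forall i, `|(v i).1| <= M /\ `|(v i).2| <= M.
  have s0 : 0 <= \sum_i (`|(v i).1| + `|(v i).2|) by rewrite sumr_ge0// => i _; rewrite addr_ge0.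
  split=> [|i]; first by rewrite lerDl.
  have : `|(v i).1| + `|(v i).2| <= M.
    rewrite /M (bigD1 i)//= addrCA lerDl addr_ge0// sumr_ge0// => j _; exact: addr_ge0.
  have := normr_ge0 (v i).1; have := normr_ge0 (v i).2; lra.
have M0 : 0 < M by lra.
(* The positive number of steps is written [K.+1], to serve as a modulus. *)
have [[|K] [// _ Ktravel]] := travel_lb A0 area M0 vM.
pose D := 3 * M; have D1 : 1 <= D by rewrite /D; lra.
have D0 : 0 <= D by lra.
(* This bounds the coefficient in [2 * (M + 1) / e], with 1 added for the rounding in [L.+1]. *)
pose Q1 := 2 * (M + 1) * (16 * D * (D + 1)) + 1.
have M10 : 0 <= M + 1 by lra.
have D10 : 0 <= D + 1 by lra.
have Q10 : 0 <= Q1 by apply: addr_ge0 => //; apply: (mulr_ge0 (mulr_ge0 _ M10) (mulr_ge0 (mulr_ge0 _ D0) D10)).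
exists (3 * Q1 ^+ 4), G, (K.+1 * 2)%N; split=> //; first by rewrite mulr_ge0// exprn_ge0.
move=> m N mm0 m_gt0.
pose g := G ^+ (m * m).
have g1 : 1 <= g by rewrite exprn_ege1.
have g0 : 0 < g by lra.
have gapm := gapG m mm0 m_gt0.
pose e := g^-1 / (16 * (N.+1%:R * D) * (N%:R * D + 1)).
pose L := Num.truncn (2 * (M + 1) / e).
have N1 : 1 <= N.+1%:R :> R by rewrite ler1n.
have Lle : L.+1%:R <= Q1 * N.+1%:R ^+ 2 * g.
  have ND : 0 < N%:R * D + 1 by rewrite ltr_wpDl//; apply: mulr_ge0.
  have Dp : 0 < D by lra.
  have eE : 2 * (M + 1) / e = 2 * (M + 1) * (16 * D) * ((N%:R * D + 1) * N.+1%:R * g).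
    by rewrite /e; field; rewrite !gt_eqF.
  have c0 : 0 <= 2 * (M + 1) * (16 * D) by exact: mulr_ge0 (mulr_ge0 _ M10) (mulr_ge0 _ D0).
  have e0 : 0 <= 2 * (M + 1) / e.
    by rewrite eE; exact: mulr_ge0 c0 (mulr_ge0 (mulr_ge0 (ltW ND) _) (ltW g0)).
  apply: (@le_trans _ _ (2 * (M + 1) / e + 1)); first by rewrite -[L.+1%:R]natr1 lerD2r truncn_le.
  rewrite eE.
  have h : N%:R * D + 1 <= (D + 1) * N.+1%:R.
    by rewrite -[N.+1%:R]natr1; have : 0 <= N%:R :> R by []; lra.
  have gN : 1 <= N.+1%:R ^+ 2 * g by rewrite mulr_ege1// exprn_ege1.
  have -> : Q1 * N.+1%:R ^+ 2 * g = 2 * (M + 1) * (16 * D) *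
      ((D + 1) * N.+1%:R * N.+1%:R * g) + N.+1%:R ^+ 2 * g by rewrite /Q1; ring.
  by rewrite lerD// ler_wpM2l// ler_wpM2r ?(ltW g0)// ler_wpM2r.
have Lbig : 2 * (M + 1) / e < L.+1%:R by exact: truncnS_gt.
have card_le k : (0 < k)%N -> (k <= N)%N ->
    (Per_exact a b k)%:R <= 3 * Q1 ^+ 4 * N.+1%:R ^+ (8 + K.+1 * 2 * (N %/ m).+1) * g ^+ 4.
  move=> k0 kN.
  pose S : {set k.-tuple 'I_3} := finset (fun w => `[< periodic_type a b w >]).
  have raysS w : w \in S ->
      exists r : (nat -> point R) * point R, billiard_ray v (code w) r.1 r.2.
    by rewrite finset.in_set => /asboolP; exact: periodic_ray.
  have gi0 : 0 < g^-1 by rewrite invr_gt0.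
  have := card_ray_codes A0 M0 area vM Ktravel kN m_gt0 gi0 gapm Lbig raysS.
  rewrite -(ler_nat R) => h.
  (* There are at most as many cyclic classes as words. *)
  apply: (@le_trans _ _ (#|S|%:R)).
    by rewrite ler_nat leq_imset_card.
  apply: (le_trans h); rewrite (natrM _ (3 * L.+1 ^ 4)) (natrM _ 3) !natrX.
  apply: (@le_trans _ _ (3 * (Q1 * N.+1%:R ^+ 2 * g) ^+ 4 *
      N.+1%:R ^+ (K.+1 * 2 * (N %/ m).+1))).
    apply: ler_pM; [by rewrite mulr_ge0 ?exprn_ge0|by rewrite exprn_ge0| |].
      rewrite ler_wpM2l// lerXn2r ?nnegrE//.
      by apply: mulr_ge0 (ltW g0); rewrite mulr_ge0 ?exprn_ge0.
    rewrite -(mulnA _ K.+1 2) (mulnC _ (K.+1 * 2)).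
    by rewrite lerXn2r ?nnegrE// ler_nat.
  rewrite exprD le_eqVlt; apply/orP; left; apply/eqP.
  move: (N.+1%:R : R) (_ ^+ (K.+1 * 2 * _)) => z1 z2; ring.
rewrite /Per natr_sum.
apply: (@le_trans _ _ (\sum_(1 <= k < N.+1) (3 * Q1 ^+ 4 * N.+1%:R ^+ (8 + K.+1 * 2 * (N %/ m).+1) * g ^+ 4))).
  rewrite big_nat_cond [leRHS]big_nat_cond; apply: ler_sum => k.
  by rewrite andbT ltnS => /andP[k0 kN]; exact: card_le.
rewrite sumr_const_nat subn1 /= -[leLHS]mulr_natl.
rewrite -/g (_ : (9 + _)%N = (8 + K.+1 * 2 * (N %/ m).+1).+1)// (exprS _ (8 + _)).
set z := _ ^+ (8 + _); set B := 3 * Q1 ^+ 4.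
rewrite (_ : B * (_ * z) * g ^+ 4 = N.+1%:R * (B * z * g ^+ 4)); last by ring.
have B0 : 0 <= B by rewrite mulr_ge0 ?exprn_ge0.
have z0 : 0 <= z by rewrite exprn_ge0.
apply: ler_wpM2r; last by rewrite ler_nat.
by apply: mulr_ge0; [exact: mulr_ge0|rewrite exprn_ge0 ?ltW].
Qed.

End TypicalTriangle.

Theorem theorem4p5 (R : realType) :
  ((@lebesgue_measure R) \x (@lebesgue_measure R))%E.-negligible
    [set ab : R * R | triangle_params ab /\
      ~ (forall eps : R, 0 < eps ->
           exists C : R, 0 < C /\
             forall n : nat, (1 <= n)%N ->
               ((Per ab.1 ab.2 n)%:R : R) <
                 C * expR ((n%:R : R) `^ (Num.sqrt 3 - 1 + eps)))].
Proof.
(* The null set consists of the pairs of angles lying in infinitely many bad sets. *)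
exists (lim_sup_set (@bad_angles R)); split.
- apply: bigcapT_measurable => n; apply: bigcup_measurable => j _; exact: measurable_bad.
- exact: bad_negligible.
move=> [a b] [[/= a0 [b0 ab]] H]; apply: contrapT => nbad; apply: H => eps eps0.
have A1 : angles a by rewrite /angles /= a0 (lt_trans _ ab)// ltrDl.
have A2 : angles b by rewrite /angles /= b0 (lt_trans _ ab)// ltrDr.
have [m0 gap_ev] := eventually_gap (ab := (a, b)) A1 A2 nbad.
have [Q [G [c [Q0 G1 bound]]]] := Per_bound a0 b0 ab gap_ev.
have [C [C0 HC]] := growth_bound m0 c Q0 G1 eps0.
exists C; split=> // n n1; have [m [m0m m_gt0 lt]] := HC n n1.
exact: le_lt_trans (bound m n m0m m_gt0) lt.
Qed.
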